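(* Let $t=T(\mathbf{y})$ be the observed value of a sufficient statistic $T$ for a realized value $u=u_0$ of a scalar random unknown, with respect to the statistical model $f(\mathbf{y}|u)$, where the random unknown $u\in\Omega_u$ is generated from a density $f_\theta(u)$ with scalar fixed unknown $\theta\in\Theta$. Suppose that for any $\alpha\in(0,1)$ the $\alpha$-quantiles of $T|u$ and of $U$ are strictly increasing functions of $u$ and of $\theta$, respectively. Define $$c(u;\mathbf{y})=\nabla_u P(T\geq t|u),\qquad c'(\theta;u)=\nabla_\theta P_\theta(U\geq u),$$ $$c_0(u;\mathbf{y})=\frac{c(u;\mathbf{y})}{f(\mathbf{y}|u)},\qquad c'_0(\theta;u)=\frac{c'(\theta;u)}{f_\theta(u)},$$ $$c_h(\theta,u;\mathbf{y})=c'_0(\theta;u)\,c_0(u;\mathbf{y})\,L_e(\theta,u;\mathbf{y}),\qquad c(\theta;\mathbf{y})=\int_{\Omega_u}c_h(\theta,u;\mathbf{y})\,du,$$ where $L_e(\theta,u;\mathbf{y})=f(\mathbf{y}|u)f_\theta(u)$. Let $\mathrm{CI}_\alpha(t)\subseteq\Theta$ and $\mathrm{PI}_\alpha(t)\subseteq\Omega_u$ be observed intervals for $\theta$ and $u$ such that $$\int_{\mathrm{CI}_\alpha(t)}c(\theta;\mathbf{y})\,d\theta=1-\alpha\quad\text{and}\quad\int_{\mathrm{PI}_\alpha(t)}c(u;\mathbf{y})\,du=1-\alpha .$$ Then for any true value $\theta_0\in\Theta$ and for any realized value $u_0\in\Omega_u$, $$P_{\theta_0}(\theta_0\in\mathrm{CI}_\alpha(T))=1-\alpha\quad\text{and}\quad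 P_{\theta_0}(u_0\in\mathrm{PI}_\alpha(T)\,|\,u_0)=1-\alpha .$$
   Context: $P_\theta$ denotes probability under parameter $\theta$. $P_{\theta_0}(\,\cdot\,|u_0)$ is the conditional probability given that the random unknown $U$ takes the realized value $u_0$, so the second probability is the conditional coverage probability; the first is computed under the marginal law of $T$ under $\theta_0$. $U$ denotes the random unknown as a random variable with density $f_\theta(u)$. The function $c_h$ is called the h-confidence (a modified extended likelihood); its marginals are the confidence density $c(\theta;\mathbf{y})$ for $\theta$ and the predictive density $c(u;\mathbf{y})$ for $u$.
   Formalization: Added: the confidence mass below the intervals CI_α(t), PI_α(t) must not depend on the data (else T|u~N(u,1) with a data-chosen tail gives coverage 1−2α at u_0=0); intervals are given for every α∈(0,1), and Θ, Ω_u are open intervals. *)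

(* Defs.v *)
From HB Require Import structures.
From mathcomp Require Import all_boot all_order all_algebra.
From mathcomp Require Import all_classical all_reals all_analysis.
Import Order.TTheory GRing.Theory Num.Theory.
Import numFieldNormedType.Exports.

Set Implicit Arguments.
Unset Strict Implicit.
Unset Printing Implicit Defensive.

Local Open Scope classical_set_scope.
Local Open Scope ring_scope.

(* Conventions: [f y u] is f(y|u), a density with respect to [mu] on the sample
   space Y, and [g theta u] is f_theta(u), a Lebesgue density on [Omega].  The
   values of [f _ u] and [g theta _] outside the parameter spaces are never
   constrained. *)

Definition cond_prob (d : measure_display) (Y : measurableType d) (R : realType)
    (mu : {sigma_finite_measure set Y -> \bar R}) (f : Y -> R -> R)
    (u : R) (A : set Y) : \bar R :=
  (\int[mu]_(y in A) (f y u)%:E)%E.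

Definition unknown_prob (R : realType) (Omega : set R) (g : R -> R -> R)
    (theta : R) (B : set R) : \bar R :=
  (\int[lebesgue_measure]_(u in Omega `&` B) (g theta u)%:E)%E.

Definition ext_lik (Y : Type) (R : realType) (f : Y -> R -> R)
    (g : R -> R -> R) (theta u : R) (y : Y) : R :=
  f y u * g theta u.

(* Law of the data under P_theta: L_e is the joint density of (y, u), and u is
   integrated out. *)
Definition marginal_prob (d : measure_display) (Y : measurableType d)
    (R : realType) (mu : {sigma_finite_measure set Y -> \bar R})
    (Omega : set R) (f : Y -> R -> R) (g : R -> R -> R)
    (theta : R) (A : set Y) : \bar R :=
  (\int[lebesgue_measure]_(u in Omega)
     \int[mu]_(y in A) (ext_lik f g theta u y)%:E)%E.

Definition quantile (R : realType) (P : set R -> \bar R) (alpha : R) : R :=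
  inf [set x | (alpha%:E <= P [set` `]-oo, x]])%E].

(* [k (T y)] is a version of the conditional probability of A given T that does
   not depend on u. *)
Definition sufficient (d : measure_display) (Y : measurableType d)
    (R : realType) (mu : {sigma_finite_measure set Y -> \bar R})
    (Omega : set R) (f : Y -> R -> R) (T : Y -> R) : Prop :=
  forall A : set Y, measurable A ->
    exists k : R -> R,
      [/\ measurable_fun [set: R] k,
          forall t, 0 <= k t <= 1 &
          forall u, Omega u -> forall B : set R, measurable B ->
            cond_prob mu f u (A `&` T @^-1` B) =
            (\int[mu]_(y in T @^-1` B) (k (T y) * f y u)%:E)%E].

(* v |-> P(T >= t | v) *)
Definition upper_T (d : measure_display) (Y : measurableType d)
    (R : realType) (mu : {sigma_finite_measure set Y -> \bar R})
    (f : Y -> R -> R) (T : Y -> R) (t v : R) : R :=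
  fine (cond_prob mu f v (T @^-1` [set` `[t, +oo[])).

(* s |-> P_s(U >= u) *)
Definition upper_U (R : realType) (Omega : set R) (g : R -> R -> R)
    (u s : R) : R :=
  fine (unknown_prob Omega g s [set` `[u, +oo[]).

(* c(u; y) *)
Definition conf_u (d : measure_display) (Y : measurableType d)
    (R : realType) (mu : {sigma_finite_measure set Y -> \bar R})
    (f : Y -> R -> R) (T : Y -> R) (u : R) (y : Y) : R :=
  derive1 (upper_T mu f T (T y)) u.

(* c'(theta; u) *)
Definition conf_theta_given_u (R : realType) (Omega : set R) (g : R -> R -> R)
    (theta u : R) : R :=
  derive1 (upper_U Omega g u) theta.

(* c_0(u; y) *)
Definition conf0_u (d : measure_display) (Y : measurableType d)
    (R : realType) (mu : {sigma_finite_measure set Y -> \bar R})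
    (f : Y -> R -> R) (T : Y -> R) (u : R) (y : Y) : R :=
  conf_u mu f T u y / f y u.

(* c'_0(theta; u) *)
Definition conf0_theta_given_u (R : realType) (Omega : set R)
    (g : R -> R -> R) (theta u : R) : R :=
  conf_theta_given_u Omega g theta u / g theta u.

(* c_h(theta, u; y) *)
Definition h_confidence (d : measure_display) (Y : measurableType d)
    (R : realType) (mu : {sigma_finite_measure set Y -> \bar R})
    (Omega : set R) (f : Y -> R -> R) (g : R -> R -> R) (T : Y -> R)
    (theta u : R) (y : Y) : R :=
  conf0_theta_given_u Omega g theta u * conf0_u mu f T u y
  * ext_lik f g theta u y.

(* c(theta; y), extended-real valued since it is defined by an integral *)
Definition conf_theta (d : measure_display) (Y : measurableType d)
    (R : realType) (mu : {sigma_finite_measure set Y -> \bar R})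
    (Omega : set R) (f : Y -> R -> R) (g : R -> R -> R) (T : Y -> R)
    (theta : R) (y : Y) : \bar R :=
  (\int[lebesgue_measure]_(u in Omega)
     (h_confidence mu Omega f g T theta u y)%:E)%E.

Definition below (R : realType) (D I : set R) : set R :=
  [set x | D x /\ forall z, I z -> x < z].

(* The confidence mass below the interval does not depend on the data: one rule
   (equal-tailed, one-sided, ...) is used at every observation.  Without it the
   tail split may be chosen after seeing the data and the coverage is not
   1 - alpha: for T|u ~ N(u, 1), taking an upper interval when t < 0 and a lower
   one when t >= 0 gives conditional coverage 1 - 2 alpha at u = 0
   (alpha < 1/2). *)
Definition fixed_tail_split (Y : Type) (R : realType) (D : set R)
    (c : R -> Y -> \bar R) (I : Y -> set R) : Prop :=
  forall y1 y2 : Y,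
    (\int[lebesgue_measure]_(x in below D (I y1)) c x y1)%E =
    (\int[lebesgue_measure]_(x in below D (I y2)) c x y2)%E.

(* Main.v *)
(* Fix the data, put [t = T y], and write [F(u) = P(T >= t | u)],
   [W_theta(u) = P_theta(U >= u)] and [K(theta) = P_theta(T >= t)].  The key
   identities are that the mass of [c(.; y)] below [u] is [F(u)] and that the mass of
   [c(.; y)] below [theta] is [K(theta)].  Increasing quantiles make [F] and
   [theta |-> W_theta(u)] nondecreasing with values in [0, 1], so Fatou's lemma
   bounds the mass of [c(.; y)] below [u] by [F(u)] and the mass above [u] by
   [1 - F(u)].  The existence of intervals of mass [1 - a] for every [a] makes the
   total mass at least 1, so both bounds are equalities.  For [theta], Tonelli turns the
   mass of [c(theta; y)] into a mixture over [u] of the masses of [c'(.; u)],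
   which are bounded in the same way by [W_theta(u)] and [1 - W_theta(u)]; a
   second use of Tonelli identifies the mixture of [W_theta] as [K(theta)].
   Finally, strictly increasing quantiles and continuity in the parameter rule
   out atoms of [T], so [P(T >= t)] evaluated at the data is uniform on [0, 1].
   With a fixed tail split [b], the event that the interval covers the parameter
   is, up to a null set, the event that this P-value lies in [b, b + 1 - alpha]. *)
Require Import Defs.
From HB Require Import structures.
From mathcomp Require Import all_boot all_order all_algebra.
From mathcomp Require Import all_classical all_reals all_analysis.
From mathcomp Require Import measurable_realfun lra ring.
Import Order.TTheory GRing.Theory Num.Theory.
Import numFieldNormedType.Exports.
Local Open Scope classical_set_scope.
Local Open Scope ring_scope.
Set Implicit Arguments.
Unset Strict Implicit.
Unset Printing Implicit Defensive.

(** * Coverage of intervals with a fixed tail split *)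

(** The thresholds [t] with P(T >= t) <= c are closed upwards, hence form an interval, and the event
    is the preimage of that interval under [T]. *)
Lemma measurable_survival_le (d : measure_display) (X : measurableType d)
    (R : realType) (P : {measure set X -> \bar R}) (T : X -> R) (c : \bar R) :
  measurable_fun [set: X] T ->
  measurable [set x | P (T @^-1` [set` `[T x, +oo[]) <= c]%E.
Proof.
move=> mT; pose U := [set t : R | (P (T @^-1` [set` `[t, +oo[]) <= c)%E].
have mI t : measurable (T @^-1` [set` `[t, +oo[]).
  by rewrite -[_ @^-1` _]setTI; apply: mT => //; exact: measurable_itv.
change (measurable (T @^-1` U)).
rewrite -[_ @^-1` _]setTI; apply: mT => //; apply: is_interval_measurable.
move=> s t Us _ z /andP[sz _]; apply: le_trans Us.
apply: le_measure; rewrite ?inE// => x /=; rewrite !in_itv/= !andbT.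
exact: le_trans.
Qed.

(** A P-value is never stochastically smaller than uniform, atoms or not. The upward closed set [U]
    of thresholds is an increasing union of rays starting at points of [U]; each ray has mass at
    most [c], and continuity from below passes this to the union. *)
Lemma survival_le (d : measure_display) (X : measurableType d) (R : realType)
    (P : {measure set X -> \bar R}) (T : X -> R) (c : \bar R) :
  measurable_fun [set: X] T -> (0 <= c)%E ->
  (P [set x | P (T @^-1` [set` `[T x, +oo[]) <= c] <= c)%E.
Proof.
move=> mT c0; pose U := [set t : R | (P (T @^-1` [set` `[t, +oo[]) <= c)%E].
have mI (i : interval R) : measurable (T @^-1` [set` i]).
  by rewrite -[_ @^-1` _]setTI; apply: mT => //; exact: measurable_itv.
have Uup s t : s <= t -> U s -> U t.
  move=> st; apply: le_trans; apply: le_measure; rewrite ?inE//.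
  by move=> x /=; rewrite !in_itv/= !andbT; exact: le_trans.
have mU : measurable (T @^-1` U) by exact: measurable_survival_le.
have lim (s : nat -> R) : (forall n, U (s n)) ->
    {homo s : m n / (m <= n)%N >-> n <= m} ->
    (forall t, U t -> exists n, s n <= t) -> (P (T @^-1` U) <= c)%E.
  move=> Us ds cov.
  have UE : T @^-1` U = \bigcup_n (T @^-1` [set` `[s n, +oo[]).
    apply/seteqP; split=> [x /cov[n sn]|x [n _] /=].
      by exists n => //=; rewrite in_itv/= andbT.
    by rewrite in_itv/= andbT => sx; exact: Uup sx (Us n).
  have /cvg_lim <- // : (P \o (fun n => T @^-1` [set` `[s n, +oo[]))
      @ \oo --> P (T @^-1` U).
    rewrite UE; apply: nondecreasing_cvg_mu => [//|| m n mn].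
    - by apply: bigcup_measurable.
    - apply/subsetPset => x /=; rewrite !in_itv/= !andbT.
      by apply: le_trans; exact: ds.
  apply: lime_le; last by apply: nearW => n; exact: Us.
  apply: ereal_nondecreasing_is_cvgn => m n mn; apply: le_measure; rewrite ?inE//.
  by move=> x /=; rewrite !in_itv/= !andbT; apply: le_trans; exact: ds.
change (P (T @^-1` U) <= c)%E.
have [->|/set0P U0] := eqVneq U set0; first by rewrite preimage_set0 measure0.
(* Three sequences exhaust [U]: [- n] if [U] is unbounded below, the constant [inf U] if the infimum
   is attained, and [inf U + 1 / (n + 1)] otherwise. *)
have [lU|nlU] := pselect (has_lbound U); last first.
  apply: (lim (fun n => - n%:R)) => [n|m n mn|t _]; last 2 first.
  - by rewrite lerN2 ler_nat.
  - exists (Num.truncn `|t|).+1; rewrite lerNl (le_trans (ler_norm _))// normrN.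
    exact/ltW/truncnS_gt.
  apply: contrapT => nU; apply: nlU; exists (- n%:R) => t Ut.
  by rewrite leNgt; apply/negP => tn; apply: nU; apply: Uup Ut; exact: ltW.
have [Ui|nUi] := pselect (U (inf U)).
  by apply: (lim (fun=> inf U)) => // t Ut; exists 0%N; exact: ge_inf.
apply: (lim (fun n => inf U + n.+1%:R^-1)) => [n|m n mn|t Ut].
- have [u Uu uU] : exists2 u, U u & u < inf U + n.+1%:R^-1.
    by apply: inf_adherent => //; split.
  by apply: Uup Uu; exact: ltW.
- by rewrite lerD2l lef_pV2 ?posrE// ler_nat.
- have tU : 0 < t - inf U.
    rewrite subr_gt0 lt_neqAle ge_inf// andbT.
    by apply/eqP => E; apply: nUi; rewrite E.
  exists (Num.truncn (t - inf U)^-1); rewrite -lerBrDl invf_ple ?posrE//.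
  exact/ltW/truncnS_gt.
Qed.

(** Shared by both halves of the theorem: [P] is the conditional law with [D] the range of u, or the
    marginal law with [D] the range of theta. The mass below the true value [x] is the P-value at
    [y], and [x] is covered according to where this P-value falls relative to [b] and
    [b + 1 - a]. *)
Lemma coverage (d : measure_display) (Y : measurableType d) (R : realType)
    (P : {measure set Y -> \bar R}) (T : Y -> R) (D : set R)
    (c : R -> Y -> \bar R) (I : Y -> set R) (a x : R) :
  P [set: Y] = 1%E -> measurable_fun [set: Y] T ->
  (forall y, P (T @^-1` [set T y]) = 0%E) ->
  is_interval D ->
  (forall y, measurable_fun D (c ^~ y)) ->
  (forall y v, D v -> 0 <= c v y)%E ->
  (forall y, \int[lebesgue_measure]_(v in D) c v y <= 1)%E ->
  (forall y, \int[lebesgue_measure]_(v in D `&` [set` `]-oo, x[]) c v y =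
     P (T @^-1` [set` `[T y, +oo[]))%E ->
  D x -> (forall y, is_interval (I y) /\ I y `<=` D) ->
  measurable [set y | I y x] -> fixed_tail_split D c I ->
  (forall y, \int[lebesgue_measure]_(v in I y) c v y = (1 - a)%:E)%E ->
  0 <= a <= 1 ->
  P [set y | I y x] = (1 - a)%:E.
Proof.
move=> P1 mT noatom Ditv mc c0 c1 pv Dx ID mA tail conf /andP[a0 a1].
have [y0 _] : [set: Y] !=set0.
  apply/set0P/negP => /eqP Y0; move: P1; rewrite Y0 measure0 => /eqP.
  by rewrite eq_sym onee_eq0.
pose mass y S := (\int[lebesgue_measure]_(v in S) c v y)%E.
pose beta := mass y0 (below D (I y0)).
have beta_y y : mass y (below D (I y)) = beta by exact: tail.
have mD := is_interval_measurable Ditv.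
have mI y : measurable (I y) by apply: is_interval_measurable; case: (ID y).
have mB y : measurable (below D (I y)).
  apply: is_interval_measurable => s t [Ds sI] [Dt tI] z /andP[sz zt].
  split=> [|w Iw]; first by apply: (Ditv _ _ Ds Dt); rewrite sz.
  exact: le_lt_trans zt (tI _ Iw).
have mass_sub y S S' : measurable S -> measurable S' -> S `<=` S' -> S' `<=` D ->
    (mass y S <= mass y S')%E.
  move=> mS mS' SS' S'D; apply: ge0_subset_integral => //.
    exact: (measurable_funS mD S'D (mc y)).
  by move=> v Sv; apply: c0; exact: S'D.
have UD y : below D (I y) `|` I y `<=` D.
  by move=> v [[]//|]; exact: (ID y).2.
have massU y : mass y (below D (I y) `|` I y) = (beta + (1 - a)%:E)%E.
  rewrite -(beta_y y) -(conf y) /mass ge0_integral_setU//.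
  - exact: mB.
  - exact: mI.
  - exact: (measurable_funS mD (UD y) (mc y)).
  - by move=> v [[Dv _]|Iv]; apply: c0 => //; apply: (ID y).2.
  - by apply/disj_setPS => v [[_ /(_ v) vI]] /vI; rewrite ltxx.
have mU y : measurable (below D (I y) `|` I y) by exact: measurableU.
have mL : measurable (D `&` [set` `]-oo, x[]).
  by apply: measurableI => //; exact: measurable_itv.
have beta0 : (0 <= beta)%E by apply: integral_ge0 => v [Dv _]; exact: c0.
(* The part below the interval and the interval are disjoint inside [D], whose mass is at most 1.
   This makes [beta] finite and keeps the upper cut-off [g] in [0, 1]. *)
have beta1 : (beta + (1 - a)%:E <= 1)%E.
  by rewrite -(massU y0); apply: le_trans (c1 y0); exact: mass_sub.
have betafin : beta \is a fin_num.
  rewrite ge0_fin_numE//; apply: le_lt_trans (ltry 1).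
  by apply: le_trans beta1; rewrite leeDl// lee_fin subr_ge0.
pose b := fine beta; have bE : beta = b%:E by rewrite fineK.
have b0 : 0 <= b by rewrite -lee_fin -bE.
have b1 : b + (1 - a) <= 1 by rewrite -lee_fin EFinD -bE.
pose g := b + (1 - a).
pose G y := P (T @^-1` [set` `[T y, +oo[]).
have GE y : G y = mass y (D `&` [set` `]-oo, x[]) by rewrite /G -pv.
(* If [x] is covered, the points of [D] left of [x] contain everything below the interval and, by
   convexity, nothing beyond the interval. *)
have Gin y : I y x -> (b%:E <= G y /\ G y <= g%:E)%E.
  move=> Ix; rewrite /g EFinD -bE GE; split.
    rewrite -(beta_y y); apply: mass_sub => // v [Dv vI].
    by split => //=; rewrite in_itv/=; exact: vI.
  rewrite -(massU y); apply: mass_sub => // v [Dv] /=; rewrite in_itv/= => vx.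
  have [Iv|nIv] := pselect (I y v); [by right|left; split => // z Iz].
  rewrite ltNge; apply/negP => zv; apply: nIv.
  by apply: ((ID y).1 _ _ Iz Ix); rewrite zv ltW.
(* An uncovered [x] has either the whole interval to its left, by convexity as soon as one point [z]
   is there, or no point of it to its left. *)
have Gout y : ~ I y x -> (G y <= b%:E \/ g%:E <= G y)%E.
  move=> nIx; rewrite /g EFinD -bE GE.
  have [[z Iz zx]|nz] := pselect (exists2 z, I y z & z <= x).
    right; rewrite -(massU y); apply: mass_sub => // v bI; split; first exact: UD bI.
    rewrite /= in_itv/=; case: bI => [[_ /(_ _ Iz) vz]|Iv].
      exact: lt_le_trans vz zx.
    rewrite ltNge; apply/negP => xv; apply: nIx.
    by apply: ((ID y).1 _ _ Iz Iv); rewrite zx.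
  left; rewrite -(beta_y y); apply: mass_sub => //.
    move=> v [Dv] /=; rewrite in_itv/= => vx; split=> // z Iz.
    by apply: lt_trans vx _; rewrite ltNge; apply/negP => zx; apply: nz; exists z.
  by move=> v [].
have mi (i : interval R) : measurable (T @^-1` [set` i]).
  by rewrite -[_ @^-1` _]setTI; apply: mT => //; exact: measurable_itv.
have Pfin A : measurable A -> P A \is a fin_num.
  move=> mA'; rewrite ge0_fin_numE//; apply: le_lt_trans (ltry 1).
  by rewrite -P1; apply: le_measure; rewrite ?inE.
pose N y := - T y.
have mN : measurable_fun [set: Y] N by exact: measurable_funN.
have NE y : N @^-1` [set` `[N y, +oo[] = T @^-1` [set` `]-oo, T y]].
  by apply/seteqP; split=> z /=; rewrite /N !in_itv/= andbT lerN2.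
(* The P-value of [- T] is P(T <= T y), which is 1 - P(T >= T y) since the atom at [T y] has mass
   zero. *)
have GN y : fine (G y) = 1 - fine (P (N @^-1` [set` `[N y, +oo[])).
  apply/eqP; rewrite eq_sym subr_eq NE -fineD ?Pfin//; apply/eqP.
  have -> : T @^-1` [set` `]-oo, T y]] =
      T @^-1` [set` `]-oo, T y[] `|` T @^-1` [set T y].
    apply/seteqP; split=> z /=; rewrite !in_itv/= le_eqVlt.
      by move=> /predU1P[|]; [right|left].
    by case=> [->|->]; rewrite ?orbT ?eqxx.
  have mt : measurable (T @^-1` [set T y]).
    by rewrite -[_ @^-1` _]setTI; exact: mT.
  rewrite measureU//; last first.
    by rewrite -subset0 => z [/=]; rewrite in_itv/= => zy E; move: zy; rewrite E ltxx.
  have n0 := noatom y; rewrite /= in n0 *; rewrite n0 adde0 -measureU//; last first.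
    by rewrite -preimage_setI -setCitvl setICl preimage_set0.
  rewrite -preimage_setU -setCitvl setvU preimage_setT.
  exact: esym (congr1 fine P1).
(* P-values of both signs are stochastically larger than uniform; as [T] has no
   atom they add up to 1, which makes [G] uniform. *)
have low r : 0 <= r -> measurable [set y | G y <= r%:E]%E /\
    (P [set y | G y <= r%:E] <= r%:E)%E.
  by move=> r0; split; [exact: measurable_survival_le|exact: survival_le].
have high r : r <= 1 -> measurable [set y | r%:E <= G y]%E /\
    (P [set y | r%:E <= G y] <= (1 - r)%:E)%E.
  move=> r1; have -> : [set y | r%:E <= G y]%E =
      [set y | P (N @^-1` [set` `[N y, +oo[]) <= (1 - r)%:E]%E.
    apply/seteqP; split=> y /=.
      rewrite -[G y]fineK ?Pfin// GN -[P _]fineK ?NE ?Pfin// !lee_fin.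
      by rewrite lerBrDl addrC -lerBrDl.
    rewrite -[G y]fineK ?Pfin// GN -[P _]fineK ?NE ?Pfin// !lee_fin.
    by rewrite lerBrDl addrC -lerBrDl.
  split; first exact: measurable_survival_le.
  by apply: survival_le => //; rewrite lee_fin subr_ge0.
set A := [set y | I y x]; have mCA : measurable (~` A) by exact: measurableC.
have g0 : 0 <= g by rewrite addr_ge0// subr_ge0.
have [mlb lb] := low _ b0; have [mlg lg] := low _ g0.
have [mhg hg] := high _ b1.
have [mhb hb] : measurable [set y | b%:E <= G y]%E /\
    (P [set y | b%:E <= G y] <= (1 - b)%:E)%E.
  by apply: high; apply: le_trans b1; rewrite lerDl subr_ge0.
have PC B : measurable B -> fine (P B) + fine (P (~` B)) = 1.
  move=> mB'; have mCB : measurable (~` B) by exact: measurableC.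
  rewrite -fineD ?Pfin// -measureU ?setICr// setUv.
  by have /= := congr1 fine P1.
rewrite -[LHS]fineK ?Pfin//; congr EFin; apply/eqP; rewrite eq_le; apply/andP; split.
  (* Upper bound: [A] and the event G > g are disjoint inside G >= b, and G > g has mass at least 1
     - g, so [A] has mass at most g - b = 1 - a. *)
  have mgt : measurable (~` [set y | G y <= g%:E]%E) by exact: measurableC.
  have : (P (A `|` ~` [set y | G y <= g%:E]) <= (1 - b)%:E)%E.
    apply: le_trans hb; apply: le_measure; rewrite ?inE//; first exact: measurableU.
    move=> y [/Gin[]//|/= /negP]; rewrite -ltNge => /ltW; apply: le_trans.
    by rewrite lee_fin lerDl subr_ge0.
  rewrite measureU//; last by rewrite -subset0 => y [/Gin[_ h]] /(_ h).
  rewrite -[X in (X <= _)%E]fineK ?fin_numD ?Pfin// fineD ?Pfin// lee_fin.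
  move: lg; rewrite -[X in (X <= _)%E]fineK ?Pfin// lee_fin.
  have := PC _ mlg; rewrite /g; lra.
(* Lower bound: the complement of [A] lies in the union of G <= b and G >= g, of mass at most b + (1
   - g) = a. *)
have : (P (~` A) <= b%:E + (1 - g)%:E)%E.
  apply: le_trans (leeD lb hg); apply: le_trans (measureU2 _ _ _) => //.
  apply: le_measure; rewrite ?inE//; first exact: measurableU.
rewrite -EFinD -[X in (X <= _)%E]fineK ?Pfin// lee_fin.
have := PC _ mA; rewrite -/A /g; lra.
Qed.

(** * Derivatives of monotone functions *)

(** Measurability and Fatou arguments need a derivative as the limit of a sequence; steps 1 / (n +
    1) to the right are fixed once and for all. *)
Lemma cvg_diff_quotient (R : realType) (phi : R -> R) (v : R) :
  derivable phi v 1 ->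
  (fun n => n.+1%:R * (phi (v + n.+1%:R^-1) - phi v)) @ \oo --> derive1 phi v.
Proof.
move=> dphi; have : h^-1 *: (phi (h + v) - phi v) @[h --> 0^'] --> derive1 phi v.
  have -> : derive1 phi v = 'D_1 phi v by rewrite derive1E.
  have := dphi; rewrite /derivable /derive => /cvg_ex[l hl].
  have E : (fun h : R => h^-1 *: (phi (h + v) - phi v)) =
           (fun h : R => h^-1 *: (phi (h *: 1 + v) - phi v)).
    by apply/funext => h; rewrite -[h *: 1]/(h * 1) mulr1.
  by rewrite E (cvg_lim _ hl).
move/cvgr_dnbhsP => /(_ (fun n => n.+1%:R^-1)) h.
have -> : (fun n => n.+1%:R * (phi (v + n.+1%:R^-1) - phi v)) =
    (fun n => (n.+1%:R^-1)^-1 *: (phi (n.+1%:R^-1 + v) - phi v)).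
  by apply/funext => n; rewrite invrK [v + _]addrC.
apply: h; split; [by move=> n; rewrite invr_eq0 pnatr_eq0|].
exact: cvg_harmonic.
Qed.

Lemma near_shift_open (R : realType) (D : set R) (v : R) : open D -> D v ->
  \forall n \near \oo, D (v + n.+1%:R^-1).
Proof.
move=> oD Dv; have := @cvgD R R^o _ \oo _ (cst v) (@harmonic R) v 0 (cvg_cst v) (@cvg_harmonic R).
by rewrite addr0; apply; exact: open_nbhs_nbhs.
Qed.

(** The derivative is a pointwise limit of difference quotients. The extension [W] by zero makes
    them measurable everywhere, and since [D] is open the shifted point is eventually in [D], where
    [W] agrees with [H]. *)
Lemma measurable_derive1_param (d : measure_display) (X : measurableType d)
    (R : realType) (A : set X) (D : set R) (H : X -> R -> R) :
  measurable A -> open D ->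
  measurable_fun (A `*` D) (fun p : X * R => H p.1 p.2) ->
  (forall x v, A x -> D v -> derivable (H x) v 1) ->
  measurable_fun (A `*` D) (fun p : X * R => derive1 (H p.1) p.2).
Proof.
move=> mA oD mH dH; pose W := (fun p : X * R => H p.1 p.2) \_ (A `*` D).
have mAD : measurable (A `*` D) by apply: measurableX => //; exact: open_measurable.
have mW : measurable_fun setT W by exact: (measurable_restrictT _ mAD).1.
apply: (@measurable_fun_cvg _ (X * R)%type R _ (fun n p =>
  n.+1%:R * (W (p.1, p.2 + n.+1%:R^-1) - W p))).
  move=> n; apply: measurable_funTS; apply: measurable_funM => //.
  apply: measurable_funB => //; apply: measurableT_comp => //.
  apply/measurable_fun_pair => //=.
  exact: measurable_funD.
move=> [x v] [/= Ax Dv]; have := cvg_diff_quotient (dH _ _ Ax Dv).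
apply: cvg_trans; apply: near_eq_cvg.
near=> n; have Dn : D (v + n.+1%:R^-1) by near: n; exact: near_shift_open.
by rewrite /W !patchE !mem_set.
Unshelve. all: by end_near. Qed.

(** Separate measurability suffices here: H x v > r holds iff H x q > r for some rational q <= v in
    [D], by continuity in one direction and monotonicity in the other. So each superlevel set is a
    countable union of rectangles. *)
Lemma measurable_monotone_param (d : measure_display) (X : measurableType d)
    (R : realType) (A : set X) (D : set R) (H : X -> R -> R) :
  measurable A -> open D ->
  (forall v, D v -> measurable_fun A (H ^~ v)) ->
  (forall x u v, A x -> D u -> D v -> u <= v -> H x u <= H x v) ->
  (forall x v, A x -> D v -> {for v, continuous (H x)}) ->
  measurable_fun (A `*` D) (fun p : X * R => H p.1 p.2).
Proof.
move=> mA oD mH ndH cH.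
have mD : measurable D by exact: open_measurable.
apply: (measurability (@RGenOInfty.G R)) => [|/= _ [_] [r] -> <-].
  exact: RGenOInfty.measurableE.
have -> : (A `*` D) `&` (fun p : X * R => H p.1 p.2) @^-1` [set` `]r, +oo[] =
    \bigcup_(q : rat) (if (ratr q : R) \in D then
      (A `&` (H ^~ (ratr q)) @^-1` [set` `]r, +oo[]) `*`
      (D `&` [set` `[ratr q : R, +oo[]) else set0).
  apply/seteqP; split=> [[x v] [[/= Ax Dv]]|[x v] [q _]].
    rewrite in_itv/= andbT => rv.
    have nb : \forall w \near v, D w /\ r < H x w.
      apply: filterI; first exact: open_nbhs_nbhs.
      exact: cvgr_gt (cH _ _ Ax Dv) _ rv.
    have [e /= e0 ev] := nb.
    have [q] := @rat_in_itvoo R (v - e) v (ltac:(by rewrite ltrBlDr ltrDl)).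
    rewrite in_itv/= => /andP[q1 q2].
    have /ev [Dq rq] : ball v e (ratr q : R).
      by rewrite /ball/= gtr0_norm ?subr_gt0// ltrBlDr -ltrBlDl.
    by exists q => //; rewrite mem_set//=; rewrite !in_itv/= !andbT ltW.
  case: ifPn => // /set_mem Dq [[/= Ax]]; rewrite !in_itv/= !andbT => rq [Dv qv].
  by split => //; apply: lt_le_trans rq _; exact: ndH.
apply: bigcupT_measurable_rat => q; case: ifPn => // /set_mem Dq.
apply: measurableX; last exact: measurableI.
by apply: mH.
Qed.

Lemma lebesgue_measure_shift (R : realType) (h : R) (A : set R) :
  measurable A ->
  lebesgue_measure (+%R^~ h @^-1` A) = lebesgue_measure A.
Proof.
have mh : measurable_fun [set: measurableTypeR R]
    (+%R^~ h : measurableTypeR R -> measurableTypeR R).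
  exact: measurable_funD.
move=> mA; apply/esym.
apply: (@lebesgue_measure_unique R (pushforward lebesgue_measure
  (+%R^~ h : measurableTypeR R -> measurableTypeR R))) => // _ [[a b] _ <-].
rewrite /pushforward/=.
set B := (X in _ = lebesgue_measure X).
have -> : B = [set` `]a - h, b - h] ].
  by apply/seteqP; split=> x /=; rewrite !in_itv/= ltrBlDr lerBrDr.
rewrite !lebesgue_measure_itv/= !lte_fin ltrD2r.
by case: ifPn => // _; rewrite -!EFinB opprB addrA subrK.
Qed.

Lemma ge0_integral_shift (R : realType) (h : R) (D : set R) (f : R -> \bar R) :
  measurable D -> measurable_fun [set: R] f -> (forall x, (0 <= f x)%E) ->
  (\int[lebesgue_measure]_(x in +%R^~ h @^-1` D) f (x + h)%R =
   \int[lebesgue_measure]_(x in D) f x)%E.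
Proof.
move=> mD mf f0.
have mh : measurable_fun [set: measurableTypeR R]
    (+%R^~ h : measurableTypeR R -> measurableTypeR R).
  exact: measurable_funD.
rewrite -(@ge0_integral_pushforward _ _ _ _ R _ mh lebesgue_measure D f)//; last first.
  exact: measurable_funTS.
by apply: eq_measure_integral => A mA _; exact: lebesgue_measure_shift.
Qed.

(** After translating by [h], the two integrals cancel except near the ends; what can remain on the
    positive side is the integral of [psi] over ]b, b + h], at most M h. *)
Lemma integral_increment_le (R : realType) (psi : R -> R) (M h a b : R) :
  {homo psi : x y / x <= y} -> (forall x, 0 <= psi x <= M) -> 0 <= h -> a <= b ->
  (\int[lebesgue_measure]_(x in [set` `[a, b]]) (psi (x + h) - psi x)%:E
     <= (M * h)%:E)%E.
Proof.
move=> nd bd h0 ab; have psi0 x : (0 <= (psi x)%:E)%E by rewrite lee_fin; case/andP: (bd x).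
have mpsi : measurable_fun [set: R] (EFin \o psi).
  by apply/measurable_EFinP; exact: nondecreasing_measurable.
have mpsih : measurable_fun [set: R] (fun x => (psi (x + h))%:E).
  apply/measurable_EFinP; apply: nondecreasing_measurable => // x y xy.
  by apply: nd; rewrite lerD2r.
have M0 : 0 <= M by case/andP: (bd 0) => /le_trans; apply.
have fin : (\int[lebesgue_measure]_(x in [set` `[a, b]]) (psi x)%:E)%E \is a fin_num.
  rewrite ge0_fin_numE ?integral_ge0//.
  apply: (@le_lt_trans _ _ (\int[lebesgue_measure]_(x in [set` `[a, b]]) (cst M%:E x))%E).
    apply: ge0_le_integral => //; first exact: measurable_funTS.
    by move=> x _; rewrite lee_fin; case/andP: (bd x).
  rewrite integral_cst//= lebesgue_measure_itv/=.
  by case: ifPn => _; rewrite -?EFinB -?EFinM ?ltry// mule0.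
rewrite -(leeD2rE _ _ fin).
have -> : (\int[lebesgue_measure]_(x in [set` `[a, b]]) (psi (x + h) - psi x)%:E +
    \int[lebesgue_measure]_(x in [set` `[a, b]]) (psi x)%:E =
    \int[lebesgue_measure]_(x in [set` `[a, b]]) (psi (x + h))%:E)%E.
  rewrite -ge0_integralD//; first last.
  - exact: measurable_funTS.
  - apply: measurable_funTS; under eq_fun do rewrite EFinB.
    exact: emeasurable_funB.
  - by move=> x _; rewrite lee_fin subr_ge0 nd// lerDl.
  by apply: eq_integral => x _; rewrite -EFinD subrK.
have -> : [set` `[a, b]] = +%R^~ h @^-1` [set` `[a + h, b + h]].
  by apply/seteqP; split=> x /=; rewrite !in_itv/= !lerD2r.
rewrite (@ge0_integral_shift _ h _ (fun x => (psi x)%:E))//.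
have -> : +%R^~ h @^-1` [set` `[a + h, b + h]] = [set` `[a, b]].
  by apply/seteqP; split=> x /=; rewrite !in_itv/= !lerD2r.
have sub : (\int[lebesgue_measure]_(x in [set` `[(a + h)%R, (b + h)%R]]) (psi x)%:E <=
    \int[lebesgue_measure]_(x in [set` `]b, (b + h)%R]] `|` [set` `[a, b]]) (psi x)%:E)%E.
  apply: ge0_subset_integral => //.
  - exact: measurableU.
  - exact: measurable_funTS.
  - move=> x /=; rewrite !in_itv/= => /andP[ax xb]; rewrite xb andbT.
    have [bx|xb'] := ltP b x; [by left|right => /=].
    by rewrite andbT (le_trans _ ax)// lerDl.
apply: (le_trans sub).
rewrite ge0_integral_setU//; last 2 first.
- exact: measurable_funTS.
- apply/disj_setPS => x [/=]; rewrite !in_itv/= => /andP[bx _] /andP[_ xb].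
  by move: (lt_le_trans bx xb); rewrite ltxx.
apply: leeD => //.
apply: (@le_trans _ _ (\int[lebesgue_measure]_(x in [set` `]b, (b + h)%R]]) (cst M%:E x))%E).
  apply: ge0_le_integral => //; first exact: measurable_funTS.
  by move=> x _; rewrite lee_fin; case/andP: (bd x).
rewrite integral_cst//= lebesgue_measure_itv/= lte_fin.
case: ifPn => _; last by rewrite mule0 lee_fin mulr_ge0.
by rewrite -EFinB -EFinM lee_fin addrAC subrr add0r.
Qed.

(* Since [derive1 phi] need not be continuous, the fundamental theorem of calculus
   is not available; this half of it follows from Fatou's lemma. *)
Lemma integral_derive1_le (R : realType) (phi : R -> R) (J : set R) (lo hi : R) :
  is_interval J ->
  (forall x, J x -> \forall n \near \oo, J (x + n.+1%:R^-1)) ->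
  (forall x y, J x -> J y -> x <= y -> phi x <= phi y) ->
  (forall x, J x -> derivable phi x 1) ->
  (forall x, J x -> lo <= phi x <= hi) -> lo <= hi ->
  (\int[lebesgue_measure]_(x in J) (derive1 phi x)%:E <= (hi - lo)%:E)%E.
Proof.
move=> Jitv Jr nd dphi bd lohi; have M0 : 0 <= hi - lo by rewrite subr_ge0.
have mJ : measurable J by exact: is_interval_measurable.
(* [psi] extends [phi - lo] monotonically to the line, by 0 left of [J] and by [hi - lo] right of
   it, so its difference quotients are nonnegative and measurable everywhere. *)
pose psi x := if x \in J then phi x - lo
  else if `[< exists2 z, J z & z < x >] then hi - lo else 0.
have psiJ x : J x -> psi x = phi x - lo by move=> Jx; rewrite /psi mem_set.
have bpsi x : 0 <= psi x <= hi - lo.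
  rewrite /psi; case: ifPn => [/set_mem/bd/andP[l h]|_].
    by rewrite subr_ge0 l lerB.
  by case: ifPn => _; rewrite ?lexx ?M0.
have ndpsi : {homo psi : x y / x <= y}.
  move=> x y; rewrite le_eqVlt => /predU1P[->//|xy].
  have [/set_mem Jx|nJx] := boolP (x \in J).
    have [/set_mem Jy|nJy] := boolP (y \in J).
      by rewrite !psiJ// lerD2r nd// ltW.
    rewrite [leRHS]/psi (negbTE nJy) asboolT; last by exists x.
    by case/andP: (bpsi x).
  rewrite [leLHS]/psi (negbTE nJx); case: asboolP => [[z Jz zx]|_]; last first.
    by case/andP: (bpsi y).
  rewrite /psi; case: ifPn => [/set_mem Jy|_].
    exfalso; move/negP: nJx; apply; apply/mem_set; apply: (Jitv _ _ Jz Jy).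
    by rewrite !ltW.
  by rewrite asboolT//; exists z => //; exact: lt_trans xy.
pose g n x := (n.+1%:R * (psi (x + n.+1%:R^-1) - psi x))%:E.
(* [integral_increment_le] works on bounded intervals; this truncation disappears in the limit
   because each point eventually lies in [I n]. *)
pose I (n : nat) : set R := [set` `[- n%:R, n%:R]].
have g0 n x : (0 <= g n x)%E.
  by rewrite lee_fin mulr_ge0// subr_ge0 ndpsi// lerDl.
have mpsi : measurable_fun [set: R] psi by exact: nondecreasing_measurable.
have mg n : measurable_fun [set: R] (g n).
  apply/measurable_EFinP; apply: measurable_funM => //.
  apply: measurable_funB => //; apply: measurableT_comp => //.
  exact: measurable_funD.
have mgI n : measurable_fun J (g n \_ (I n)).
  apply: measurable_funTS; apply: (measurable_restrictT _ (measurable_itv _)).1.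
  exact: measurable_funTS.
have gI0 n x : J x -> (0 <= (g n \_ (I n)) x)%E.
  by move=> _; exact: erestrict_ge0.
have := fatou lebesgue_measure mJ mgI gI0.
set L := (X in (X <= _)%E -> _).
have -> : L = (\int[lebesgue_measure]_(x in J) (derive1 phi x)%:E)%E.
  apply: eq_integral => x /set_mem Jx.
  apply: (cvg_limn_einf_sup _).1.
  have lim : (fun n => (n.+1%:R * (phi (x + n.+1%:R^-1) - phi x))%:E) @ \oo -->
      (derive1 phi x)%:E.
    by apply: cvg_EFin; [exact: nearW|exact: cvg_diff_quotient (dphi _ Jx)].
  apply: cvg_trans lim.
  apply: near_eq_cvg.
  near=> n.
  have Jn : J (x + n.+1%:R^-1) by near: n; exact: Jr.
  rewrite patchE mem_set; last first.
    rewrite /I /= in_itv/= -ler_norml.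
    near: n; exact: nbhs_infty_ger.
  by rewrite /g !psiJ// opprB addrA subrK.
move/le_trans; apply; rewrite limn_einf_lim; apply: lime_le.
  exact: is_cvg_einfs.
apply: nearW => n; apply: (@le_trans _ _ (\int[lebesgue_measure]_(x in J) (g n \_ (I n)) x)%E).
  by apply: ereal_inf_lbound; exists n => /=.
rewrite -integral_mkcondr.
apply: (@le_trans _ _ (\int[lebesgue_measure]_(x in I n) g n x)%E).
  apply: ge0_subset_integral => //.
  - by apply: measurableI => //; exact: measurable_itv.
  - exact: measurable_itv.
  - by apply: measurable_funTS; exact: mg.
rewrite /g; under eq_integral do rewrite EFinM.
rewrite ge0_integralZl_EFin//; last 3 first.
- exact: measurable_itv.
- by move=> x _; rewrite lee_fin subr_ge0 ndpsi// lerDl.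
- apply/measurable_EFinP; apply: measurable_funTS.
  apply: measurable_funB => //; apply: measurableT_comp => //.
  exact: measurable_funD.
have nn : - n%:R <= n%:R :> R by rewrite lerNl (le_trans _ (ler0n _ _))// oppr_le0.
have hn : 0 <= n.+1%:R^-1 :> R by [].
(* The factor n + 1 of the quotient cancels the step 1 / (n + 1), which leaves [hi - lo] for every
   n. *)
apply: (le_trans (lee_wpmul2l _ (integral_increment_le ndpsi bpsi hn nn))) => //.
by rewrite -EFinM lee_fin mulrCA divff ?mulr1// pnatr_eq0.
Unshelve. all: by end_near. Qed.

(** * Tonelli's theorem on rectangles, and measurable sections *)

Lemma measurable_integral_setX (d1 d2 : measure_display)
    (X1 : measurableType d1) (X2 : measurableType d2) (R : realType)
    (m2 : {sigma_finite_measure set X2 -> \bar R})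
    (A : set X1) (B : set X2) (F : X1 * X2 -> \bar R) :
  measurable A -> measurable B -> measurable_fun (A `*` B) F ->
  (forall x y, A x -> B y -> (0 <= F (x, y))%E) ->
  measurable_fun A (fun x => \int[m2]_(y in B) F (x, y))%E.
Proof.
move=> mA mB mF F0; pose G := F \_ (A `*` B).
have mG : measurable_fun setT G by exact: (measurable_restrictT _ (measurableX mA mB)).1.
have G0 p : (0 <= G p)%E by apply: erestrict_ge0 => -[x y] [Ax By]; exact: F0.
apply: eq_measurable_fun (measurable_funTS
  (@measurable_fun_fubini_tonelli_F _ _ _ _ _ m2 G mG G0)).
move=> x /set_mem Ax; rewrite /fubini_F [RHS]integral_mkcond.
apply: eq_integral => y _; rewrite /G !patchE.
have [/set_mem By|nBy] := boolP (y \in B); first by rewrite mem_set.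
by rewrite ifF//; apply/negP => /set_mem[_ /= By]; move/negP: nBy; apply; exact/mem_set.
Qed.

Lemma tonelli_setX (d1 d2 : measure_display)
    (X1 : measurableType d1) (X2 : measurableType d2) (R : realType)
    (m1 : {sigma_finite_measure set X1 -> \bar R})
    (m2 : {sigma_finite_measure set X2 -> \bar R})
    (A : set X1) (B : set X2) (F : X1 * X2 -> \bar R) :
  measurable A -> measurable B -> measurable_fun (A `*` B) F ->
  (forall x y, A x -> B y -> (0 <= F (x, y))%E) ->
  (\int[m1]_(x in A) \int[m2]_(y in B) F (x, y) =
   \int[m2]_(y in B) \int[m1]_(x in A) F (x, y))%E.
Proof.
move=> mA mB mF F0; pose G := F \_ (A `*` B).
have mG : measurable_fun setT G by exact: (measurable_restrictT _ (measurableX mA mB)).1.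
have G0 p : (0 <= G p)%E by apply: erestrict_ge0 => -[x y] [Ax By]; exact: F0.
have GE x y : G (x, y) = if (x \in A) && (y \in B) then F (x, y) else 0%E.
  by rewrite /G patchE in_setX.
have := @fubini_tonelli _ _ _ _ _ m1 m2 G mG G0.
under eq_integral => x _.
  rewrite (_ : (\int[m2]_y G (x, y))%E = ((fun x => \int[m2]_(y in B) F (x, y))%E \_ A) x); last first.
    rewrite patchE; case: ifPn => xA.
      rewrite [RHS]integral_mkcond; apply: eq_integral => y _.
      by rewrite GE xA patchE.
    by rewrite integral0_eq// => y _; rewrite GE (negbTE xA).
  over.
rewrite -integral_mkcond => ->; rewrite [RHS]integral_mkcond.
apply: eq_integral => y _; rewrite patchE; case: ifPn => yB.
  rewrite [RHS]integral_mkcond; apply: eq_integral => x _.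
  by rewrite GE yB andbT patchE.
by rewrite integral0_eq// => x _; rewrite GE (negbTE yB) andbF.
Qed.

Lemma measurable_fun_section1 (d1 d2 d3 : measure_display)
    (X1 : measurableType d1) (X2 : measurableType d2) (X3 : measurableType d3)
    (A : set X1) (B : set X2) (F : X1 -> X2 -> X3) (x : X1) :
  measurable A -> measurable B ->
  measurable_fun (A `*` B) (fun p : X1 * X2 => F p.1 p.2) -> A x ->
  measurable_fun B (F x).
Proof.
move=> mA mB mF Ax.
apply: (@measurable_comp _ _ _ _ _ _ (A `*` B) (fun p : X1 * X2 => F p.1 p.2)
  B (fun y => (x, y))) => //; first exact: measurableX.
  by move=> _ [y By <-].
by apply: measurable_funTS; exact: pair1_measurable.
Qed.

Lemma measurable_fun_section2 (d1 d2 d3 : measure_display)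
    (X1 : measurableType d1) (X2 : measurableType d2) (X3 : measurableType d3)
    (A : set X1) (B : set X2) (F : X1 -> X2 -> X3) (y : X2) :
  measurable A -> measurable B ->
  measurable_fun (A `*` B) (fun p : X1 * X2 => F p.1 p.2) -> B y ->
  measurable_fun A (F ^~ y).
Proof.
move=> mA mB mF By.
apply: (@measurable_comp _ _ _ _ _ _ (A `*` B) (fun p : X1 * X2 => F p.1 p.2)
  A (fun x => (x, y))) => //; first exact: measurableX.
  by move=> _ [x Ax <-].
by apply: measurable_funTS; exact: pair2_measurable.
Qed.

(** * Mass of the derivative of a monotone function on either side of a point *)

Lemma measurable_derive1_monotone (R : realType) (D : set R) (phi : R -> R) :
  open D -> (forall x y, D x -> D y -> x <= y -> phi x <= phi y) ->
  (forall x, D x -> derivable phi x 1) -> measurable_fun D (derive1 phi).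
Proof.
move=> oD nd dphi.
(* The version without parameter is the case of the one-point parameter space [unit]. *)
apply: (@measurable_fun_section1 _ _ _ unit R R setT D (fun=> derive1 phi) tt) => //.
  exact: open_measurable.
apply: (@measurable_derive1_param _ unit R setT D (fun=> phi)) => //.
apply: (@measurable_monotone_param _ unit R setT D (fun=> phi)) => //.
- by move=> _ x y _; exact: nd.
- move=> _ x _ Dx; apply: differentiable_continuous; exact/derivable1_diffP/dphi.
- by move=> _ x _; exact: dphi.
Qed.

Lemma derive1_monotone_ge0 (R : realType) (D : set R) (phi : R -> R) (x : R) :
  open D -> (forall x y, D x -> D y -> x <= y -> phi x <= phi y) ->
  derivable phi x 1 -> D x -> 0 <= derive1 phi x.
Proof.
move=> oD nd dphi Dx; have /cvg_lim <- // := cvg_diff_quotient dphi.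
apply: limr_ge; first by apply/cvg_ex; eexists; exact: cvg_diff_quotient dphi.
near=> n; have Dn : D (x + n.+1%:R^-1) by near: n; exact: near_shift_open.
by rewrite mulr_ge0// subr_ge0 nd// lerDl.
Unshelve. all: by end_near. Qed.

Lemma is_interval_setI_itv (R : realType) (D : set R) (i : interval R) :
  is_interval D -> is_interval (D `&` [set` i]).
Proof.
move=> Ditv s t [Ds si] [Dt ti] z szt; split; first exact: Ditv szt.
exact: interval_is_interval szt.
Qed.

Lemma integral_derive1_below (R : realType) (D : set R) (phi : R -> R) (x : R) :
  open D -> is_interval D ->
  (forall x y, D x -> D y -> x <= y -> phi x <= phi y) ->
  (forall x, D x -> derivable phi x 1) -> (forall x, D x -> 0 <= phi x) -> D x ->
  (\int[lebesgue_measure]_(v in D `&` [set` `]-oo, x[]) (derive1 phi v)%:E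
    <= (phi x)%:E)%E.
Proof.
move=> oD Ditv nd dphi bd Dx; rewrite -[phi x]subr0.
apply: integral_derive1_le.
- exact: is_interval_setI_itv.
- move=> v [Dv /= vx].
  have : open (D `&` [set` `]-oo, x[]) by apply: openI => //; exact: interval_open.
  by move/near_shift_open; apply; split.
- by move=> u v [Du _] [Dv _]; exact: nd.
- by move=> v [Dv _]; exact: dphi.
- move=> v [Dv /=]; rewrite in_itv/= => vx.
  by rewrite bd//= nd// ltW.
- exact: bd.
Qed.

Lemma integral_derive1_above (R : realType) (D : set R) (phi : R -> R) (x : R) :
  open D -> is_interval D ->
  (forall x y, D x -> D y -> x <= y -> phi x <= phi y) ->
  (forall x, D x -> derivable phi x 1) -> (forall x, D x -> phi x <= 1) -> D x ->
  (\int[lebesgue_measure]_(v in D `&` [set` `[x, +oo[]) (derive1 phi v)%:E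
    <= (1 - phi x)%:E)%E.
Proof.
move=> oD Ditv nd dphi bd Dx; apply: integral_derive1_le.
- exact: is_interval_setI_itv.
(* The set is closed at its left end [x], which is harmless because the shifts go to the right. *)
- move=> v [Dv]; rewrite /= in_itv/= andbT => xv; near=> n.
  split; last by rewrite /= in_itv/= andbT (le_trans xv)// lerDl.
  by near: n; exact: near_shift_open.
- by move=> u v [Du _] [Dv _]; exact: nd.
- by move=> v [Dv _]; exact: dphi.
- move=> v [Dv /=]; rewrite in_itv/= andbT => vx.
  by rewrite bd// nd.
- exact: bd.
Unshelve. all: by end_near. Qed.

(* The two bounds add up to 1 while the total mass is at least [1 - a] for every
   [a], so the bounds are attained. *)
Lemma mass_below_eq (R : realType) (D : set R) (c : R -> \bar R) (x p : R) :
  measurable D -> measurable_fun D c -> (forall v, D v -> 0 <= c v)%E ->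
  (forall a : R, 0 < a < 1 -> exists J, [/\ measurable J, J `<=` D &
     (\int[lebesgue_measure]_(v in J) c v = (1 - a)%:E)%E]) ->
  (\int[lebesgue_measure]_(v in D `&` [set` `]-oo, x[]) c v <= p%:E)%E ->
  (\int[lebesgue_measure]_(v in D `&` [set` `[x, +oo[]) c v <= (1 - p)%:E)%E ->
  (\int[lebesgue_measure]_(v in D `&` [set` `]-oo, x[]) c v = p%:E)%E /\
  (\int[lebesgue_measure]_(v in D) c v = 1)%E.
Proof.
move=> mD mc c0 masses.
have : forall a : R, 0 < a < 1 ->
    ((1 - a)%:E <= \int[lebesgue_measure]_(v in D) c v)%E.
  move=> a /masses[J [mJ JD <-]]; exact: ge0_subset_integral.
have -> : (\int[lebesgue_measure]_(v in D) c v =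
    \int[lebesgue_measure]_(v in D `&` [set` `]-oo, x[]) c v +
    \int[lebesgue_measure]_(v in D `&` [set` `[x, +oo[]) c v)%E.
  rewrite -ge0_integral_setU.
  - by rewrite -setIUr -setCitvl setUv setIT.
  - by apply: measurableI => //; exact: measurable_itv.
  - by apply: measurableI => //; exact: measurable_itv.
  - by apply: (measurable_funS mD _ mc) => v [[]|[]].
  - by move=> v [[Dv _]|[Dv _]]; exact: c0.
  - apply/disj_setPS => v [[_ /=]]; rewrite in_itv/= => vx [_ /=].
    by rewrite in_itv/= andbT leNgt vx.
have ge0 S : S `<=` D -> (0 <= \int[lebesgue_measure]_(v in S) c v)%E.
  by move=> SD; apply: integral_ge0 => v /SD; exact: c0.
set L := (\int[lebesgue_measure]_(v in _ `&` [set` `]-oo, x[]) _)%E.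
set U := (\int[lebesgue_measure]_(v in _ `&` [set` `[x, +oo[]) _)%E.
move=> tot Lp Up.
have L0 : (0 <= L)%E by apply: ge0; exact: subIsetl.
have U0 : (0 <= U)%E by apply: ge0; exact: subIsetl.
have LE : L = (fine L)%:E by rewrite fineK// ge0_fin_numE// (le_lt_trans Lp (ltry _)).
have UE : U = (fine U)%:E by rewrite fineK// ge0_fin_numE// (le_lt_trans Up (ltry _)).
move: tot L0 U0 Lp Up; rewrite LE UE !lee_fin.
move: (fine L) (fine U) => l u tot l0 u0 lp up.
have {}tot (a : R) : 0 < a < 1 -> 1 - a <= l + u by move/tot; rewrite -EFinD lee_fin.
have lu : 1 <= l + u.
  rewrite leNgt; apply/negP => lt.
  (* Taking for [a] half of the missing mass would require more mass than [l + u]. *)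
  have /tot : 0 < (1 - (l + u)) / 2 < 1 by lra.
  lra.
by split; [congr EFin|rewrite -EFinD; congr EFin]; lra.
Qed.

(** * Families with increasing quantiles *)

(** If the inequality failed at [x], then P(X < x) < Q(X <= x), and any level [a] strictly between
    would put the [a]-quantile of [Q] at or below [x] and that of [P] at or above [x]. *)
Lemma quantile_survival_le (R : realType) (P Q : {measure set R -> \bar R}) :
  P [set: R] = 1%E -> Q [set: R] = 1%E ->
  (forall a : R, 0 < a < 1 -> quantile P a < quantile Q a) ->
  forall x, (P [set` `[x, +oo[] <= Q [set` `]x, +oo[])%E.
Proof.
move=> P1 Q1 PQ x.
have fin (m : {measure set R -> \bar R}) : m [set: R] = 1%E ->
    forall A, measurable A -> m A \is a fin_num /\ (m A <= 1)%E.
  move=> m1 A mA; have mA1 : (m A <= 1)%E.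
    by rewrite -m1; apply: le_measure; rewrite ?inE.
  by rewrite ge0_fin_numE//; split => //; exact: le_lt_trans mA1 (ltry _).
have splitP (m : {measure set R -> \bar R}) (i j : interval R) :
    m [set: R] = 1%E -> [set` i] `|` [set` j] = [set: R] ->
    [set` i] `&` [set` j] = set0 -> fine (m [set` i]) = 1 - fine (m [set` j]).
  move=> m1 U I; apply/eqP; rewrite eq_sym subr_eq -fineD ?(fin m m1 _ _).1//.
  rewrite -measureU// U; apply/eqP; exact: esym (congr1 fine m1).
rewrite leNgt; apply/negP => QP.
have mi (i : interval R) : measurable [set` i] by exact: measurable_itv.
have EP : fine (P [set` `]-oo, x[]) = 1 - fine (P [set` `[x, +oo[]).
  by apply: splitP => //; [rewrite -setCitvl setUv|rewrite -setCitvl setICr].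
have EQ : fine (Q [set` `]-oo, x]]) = 1 - fine (Q [set` `]x, +oo[]).
  by apply: splitP => //; [rewrite -setCitvl setUv|rewrite -setCitvl setICr].
have lt : fine (P [set` `]-oo, x[]) < fine (Q [set` `]-oo, x]]).
  by rewrite EP EQ ltrD2l ltrN2 -lte_fin !fineK ?(fin _ P1 _ _).1 ?(fin _ Q1 _ _).1.
pose a := (fine (P [set` `]-oo, x[]) + fine (Q [set` `]-oo, x]])) / 2.
have Pa : fine (P [set` `]-oo, x[]) < a by rewrite midf_lt.
have aQ : a < fine (Q [set` `]-oo, x]]) by rewrite midf_lt.
have a01 : 0 < a < 1.
  apply/andP; split; first exact: le_lt_trans Pa.
  apply: lt_le_trans aQ _; rewrite -lee_fin fineK ?(fin _ Q1 _ _).1//.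
  exact: (fin _ Q1 _ _).2.
have := PQ _ a01; apply/negP; rewrite -leNgt.
apply: (@le_trans _ _ x).
  apply: ge_inf; last first.
    by rewrite /= -[X in (_ <= X)%E]fineK ?(fin _ Q1 _ _).1// lee_fin ltW.
  (* [inf] bounds its set from below only if the set has a lower bound. One exists because the
     distribution function of [Q] tends to 0 at minus infinity and [a] is positive. *)
  have cv : Q \o (fun n => [set` `]-oo, - n%:R : R]]) @ \oo -->
            Q (\bigcap_n [set` `]-oo, - n%:R : R]]).
    apply: nonincreasing_cvg_mu => //.
    - by rewrite ltey_eq (fin _ Q1 _ _).1.
    - exact: bigcap_measurable.
    - move=> m n mn; apply/subsetPset => z /=; rewrite !in_itv/= => zn.
      by apply: le_trans zn _; rewrite lerN2 ler_nat.
  have E0 : \bigcap_n [set` `]-oo, - n%:R : R]] = set0.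
    rewrite -subset0 => z /= /(_ (Num.truncn `|z|).+1 I) /=; rewrite in_itv/=.
    rewrite lerNr leNgt => /negP; apply; apply: le_lt_trans (truncnS_gt _).
    by rewrite -normrN; exact: ler_norm.
  rewrite E0 measure0 in cv.
  have /cv [n _ /(_ n (leqnn _))/= Qn] : nbhs (0%E : \bar R) [set e | (e < a%:E)%E].
    by apply: (@nbhs_open_ereal_lt _ _ (fun=> a)); case/andP: a01.
  exists (- n%:R) => z /= az; rewrite leNgt; apply/negP => zn.
  have := lt_le_trans Qn az; apply/negP; rewrite -leNgt.
  apply: le_measure; rewrite ?inE// => y /=; rewrite !in_itv/= => yz.
  exact: le_trans yz (ltW zn).
apply: lb_le_inf; last first.
  move=> z /= az; rewrite leNgt; apply/negP => zx.
  have : (P [set` `]-oo, z]] <= P [set` `]-oo, x[])%E.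
    by apply: le_measure; rewrite ?inE// => y /=; rewrite !in_itv/= => /le_lt_trans; apply.
  move/(le_trans az); rewrite -[X in (_ <= X)%E]fineK ?(fin _ P1 _ _).1//.
  by rewrite lee_fin leNgt Pa.
(* [inf] of an empty set is a default value; the level set is nonempty because the distribution
   function of [P] tends to 1 and [a < 1]. *)
have cv : P \o (fun n => [set` `]-oo, n%:R : R]]) @ \oo -->
          P (\bigcup_n [set` `]-oo, n%:R : R]]).
  apply: nondecreasing_cvg_mu => //.
  - exact: bigcup_measurable.
  - move=> m n mn; apply/subsetPset => z /=; rewrite !in_itv/= => zn.
    by apply: le_trans zn _; rewrite ler_nat.
have E1 : \bigcup_n [set` `]-oo, n%:R : R]] = [set: R].
  rewrite -subTset => z _; exists (Num.truncn `|z|).+1 => //=; rewrite in_itv/=.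
  by apply: le_trans (ler_norm _) _; exact/ltW/truncnS_gt.
rewrite E1 P1 in cv.
have /cv [n _ /(_ n (leqnn _))/= Qn] : nbhs (1%E : \bar R) [set e | (a%:E < e)%E].
  by apply: (@nbhs_open_ereal_gt _ _ (fun=> a)); case/andP: a01.
by exists n%:R => /=; exact: ltW.
Qed.

(** The laws of the model are plain set functions. [quantile] evaluates them on rays only, so they
    may be replaced by measures that agree with them on Borel sets. *)
Lemma survival_quantile_le (R : realType) (D : set R) (Q : R -> set R -> \bar R) :
  (forall u, D u -> exists2 m : {measure set R -> \bar R},
     m [set: R] = 1%E & forall B, measurable B -> m B = Q u B) ->
  (forall a : R, 0 < a < 1 -> forall u v, D u -> D v -> u < v ->
     quantile (Q u) a < quantile (Q v) a) ->
  forall u v x, D u -> D v -> u < v ->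
    (Q u [set` `[x, +oo[] <= Q v [set` `]x, +oo[])%E.
Proof.
move=> Qm Qq u v x Du Dv uv.
have [m m1 mE] := Qm _ Du; have [n n1 nE] := Qm _ Dv.
rewrite -mE ?measurable_itv// -nE ?measurable_itv//.
apply: quantile_survival_le => // a a01; have := Qq _ a01 _ _ Du Dv uv.
congr (inf _ < inf _); apply/seteqP; split=> y /=.
all: by rewrite ?mE ?nE ?measurable_itv//.
Qed.

(** * The conditional, unknown and marginal laws as measures *)

Lemma pushforward_measure (d : measure_display) (Y : measurableType d)
    (R : realType) (m : {measure set Y -> \bar R}) (T : Y -> R) :
  measurable_fun [set: Y] T ->
  exists n : {measure set R -> \bar R}, forall B, n B = m (T @^-1` B).
Proof.
move=> mT; unshelve eexists (pushforward m T : {measure set R -> \bar R}).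
  exact: mT.
by [].
Qed.

Lemma density_measure (d : measure_display) (X : measurableType d) (R : realType)
    (mu : {measure set X -> \bar R}) (h : X -> \bar R) :
  measurable_fun [set: X] h -> (forall x, 0 <= h x)%E ->
  exists m : {measure set X -> \bar R},
    forall A, m A = (\int[mu]_(x in A) h x)%E.
Proof.
move=> mh h0; pose m (A : set X) := (\int[mu]_(x in A) h x)%E.
have m0 : m set0 = 0%E by rewrite /m integral_set0.
have m_ge0 A : (0 <= m A)%E by exact: integral_ge0.
have m_sigma : semi_sigma_additive m.
  move=> F mF tF mUF; rewrite /m; apply: cvg_toP.
    apply: ereal_nondecreasing_is_cvgn => p q pq.
    by apply: lee_sum_nneg_natr => // k _ _; exact: integral_ge0.
  by rewrite ge0_integral_bigcup//; exact: measurable_funTS.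
pose mm := isMeasure.Build d X R m m0 m_ge0 m_sigma.
pose mM : {measure set X -> \bar R} := HB.pack m mm.
by exists mM.
Qed.

Lemma cond_prob_measure (d : measure_display) (Y : measurableType d)
    (R : realType) (mu : {sigma_finite_measure set Y -> \bar R})
    (Omega : set R) (f : Y -> R -> R) (u : R) :
  measurable Omega ->
  measurable_fun ([set: Y] `*` Omega) (fun p : Y * R => f p.1 p.2) ->
  (forall y v, Omega v -> 0 <= f y v) -> Omega u ->
  exists m : {measure set Y -> \bar R}, forall A, m A = cond_prob mu f u A.
Proof.
move=> mO mf f0 Ou; apply: (density_measure mu (h := fun y => (f y u)%:E)).
  apply/measurable_EFinP.
  exact: measurable_fun_section2 measurableT mO mf Ou.
by move=> y; rewrite lee_fin f0.
Qed.

Lemma unknown_prob_measure (R : realType) (Omega : set R) (g : R -> R -> R)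
    (theta : R) :
  measurable Omega -> measurable_fun Omega (g theta) ->
  (forall u, Omega u -> 0 <= g theta u) ->
  exists m : {measure set R -> \bar R}, forall A, m A = unknown_prob Omega g theta A.
Proof.
move=> mO mg g0.
have [||m mE] := @density_measure _ (measurableTypeR R) R lebesgue_measure
  ((fun u => (g theta u)%:E) \_ Omega).
- by apply: (measurable_restrictT _ mO).1; exact/measurable_EFinP.
- by apply: erestrict_ge0 => u Ou; rewrite lee_fin g0.
(* Pushing forward by the identity keeps all values and only moves the measure from
   [measurableTypeR R] to [R]. *)
have [|n nE] := @pushforward_measure _ (measurableTypeR R) R m idfun.
  exact: measurable_id.
by exists n => A; rewrite nE mE /unknown_prob setIC integral_mkcondr.
Qed.

(** Tonelli exchanges the integrals and exhibits the marginal law as the measure with density y |->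
    int f(y|u) f_theta(u) du. The exchange is why the equality is restricted to measurable
    events. *)
Lemma marginal_prob_measure (d : measure_display) (Y : measurableType d)
    (R : realType) (mu : {sigma_finite_measure set Y -> \bar R})
    (Omega : set R) (f : Y -> R -> R) (g : R -> R -> R) (theta : R) :
  measurable Omega ->
  measurable_fun ([set: Y] `*` Omega) (fun p : Y * R => f p.1 p.2) ->
  (forall y v, Omega v -> 0 <= f y v) ->
  measurable_fun Omega (g theta) -> (forall u, Omega u -> 0 <= g theta u) ->
  exists m : {measure set Y -> \bar R},
    forall A, measurable A -> m A = marginal_prob mu Omega f g theta A.
Proof.
move=> mO mf f0 mg g0.
pose F (p : Y * R) := (ext_lik f g theta p.2 p.1)%:E.
have mF : measurable_fun ([set: Y] `*` Omega) F.
  apply/measurable_EFinP; apply: measurable_funM => //.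
  apply: (@measurable_comp _ _ _ _ _ _ Omega (g theta) _ snd) => //.
    by move=> _ [[y u] [_ /= Ou] <-].
  by apply: measurable_funTS; exact: measurable_snd.
have F0 y u : Omega u -> (0 <= F (y, u))%E.
  by move=> Ou; rewrite lee_fin mulr_ge0 ?f0 ?g0.
have [||m mE] := @density_measure _ Y R mu
  (fun y => \int[lebesgue_measure]_(u in Omega) F (y, u))%E.
- by apply: (@measurable_integral_setX _ _ Y (measurableTypeR R) R lebesgue_measure
    setT Omega F) => // y u _; exact: F0.
- by move=> y; apply: integral_ge0 => u; exact: F0.
exists m => A mA; rewrite mE.
apply: (@tonelli_setX _ _ Y (measurableTypeR R) R mu lebesgue_measure A Omega F) => //.
by apply: measurable_funS mF => //; [exact: measurableX|move=> p []].
by move=> y u _; exact: F0.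
Qed.

(** * Survival functions as functions of the parameter *)

Lemma survival_range (R : realType) (D : set R) (Q : R -> set R -> \bar R) :
  (forall u, D u -> exists2 m : {measure set R -> \bar R},
     m [set: R] = 1%E & forall B, measurable B -> m B = Q u B) ->
  forall u B, D u -> measurable B ->
    Q u B \is a fin_num /\ 0 <= fine (Q u B) <= 1.
Proof.
move=> Qm u B Du mB; have [m m1 mE] := Qm _ Du; rewrite -mE//.
have mB1 : (m B <= 1)%E by rewrite -m1; apply: le_measure; rewrite ?inE.
have mf : m B \is a fin_num.
  by rewrite ge0_fin_numE//; exact: le_lt_trans mB1 (ltry _).
by split => //; rewrite fine_ge0//= -lee_fin fineK.
Qed.

Lemma survival_monotone (R : realType) (D : set R) (Q : R -> set R -> \bar R) :
  (forall u, D u -> exists2 m : {measure set R -> \bar R},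
     m [set: R] = 1%E & forall B, measurable B -> m B = Q u B) ->
  (forall a : R, 0 < a < 1 -> forall u v, D u -> D v -> u < v ->
     quantile (Q u) a < quantile (Q v) a) ->
  forall x u v, D u -> D v -> u <= v ->
    fine (Q u [set` `[x, +oo[]) <= fine (Q v [set` `[x, +oo[]).
Proof.
move=> Qm Qq x u v Du Dv; rewrite le_eqVlt => /predU1P[->//|uv].
apply: fine_le; rewrite ?(survival_range Qm _ _).1 ?measurable_itv//.
apply: (le_trans (survival_quantile_le Qm Qq _ Du Dv uv)).
have [n n1 nE] := Qm _ Dv; rewrite -!nE ?measurable_itv//.
apply: le_measure; rewrite ?inE ?measurable_itv// => z /=.
by rewrite !in_itv/= !andbT => /ltW.
Qed.

(* [P_u(X >= x) <= P_v(X > x)] for [u < v] and [P_v(X >= x)] is the limit of the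
   left-hand side as [u] tends to [v]. *)
Lemma survival_no_atom (R : realType) (D : set R) (Q : R -> set R -> \bar R)
    (x v : R) :
  open D ->
  (forall u, D u -> exists2 m : {measure set R -> \bar R},
     m [set: R] = 1%E & forall B, measurable B -> m B = Q u B) ->
  (forall a : R, 0 < a < 1 -> forall u v, D u -> D v -> u < v ->
     quantile (Q u) a < quantile (Q v) a) ->
  D v -> {for v, continuous (fun w => fine (Q w [set` `[x, +oo[]))} ->
  Q v [set x] = 0%E.
Proof.
move=> oD Qm Qq Dv cS.
have fin u B Du mB := (survival_range Qm (u := u) (B := B) Du mB).1.
have le : fine (Q v [set` `[x, +oo[]) <= fine (Q v [set` `]x, +oo[]).
  rewrite leNgt; apply/negP => lt.
  have nb : \forall u \near v,
      D u /\ fine (Q v [set` `]x, +oo[]) < fine (Q u [set` `[x, +oo[]).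
    apply: filterI; first exact: open_nbhs_nbhs.
    exact: cvgr_gt cS _ lt.
  have [e /= e0 ev] := nb.
  (* A parameter left of [v] but still in the neighbourhood contradicts [survival_quantile_le]. *)
  have [] := ev (v - e / 2).
    by rewrite /ball/= opprB addrC subrK gtr0_norm ?divr_gt0// gtr_pMr// invf_lt1// ltr1n.
  move=> Du; apply/negP; rewrite -leNgt.
  apply: fine_le; rewrite ?fin ?measurable_itv//.
  by apply: (survival_quantile_le Qm Qq) => //; rewrite gtrDl oppr_lt0 divr_gt0.
have [n n1 nE] := Qm _ Dv.
have mx : measurable ([set x] : set R) by rewrite -set_itv1; exact: measurable_itv.
move: le; rewrite -!nE ?measurable_itv//.
have nfin B : measurable B -> n B \is a fin_num by move=> mB; rewrite nE// fin.
have -> : [set` `[x, +oo[] = [set x] `|` [set` `]x, +oo[].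
  by rewrite setU1itv.
rewrite measureU ?measurable_itv//; last first.
  by rewrite -subset0 => z [->] /=; rewrite in_itv/= ltxx.
rewrite fineD ?nfin ?measurable_itv// gerDr => le0.
apply/eqP; rewrite -[n _]fineK ?nfin//; apply/eqP; congr EFin; apply/eqP.
by rewrite eq_le le0 fine_ge0.
Qed.

(** * Mixing over the random unknown *)

(** [C] mixes the derivatives of the [W u] with weight [c]. Integrating over [s] first, for fixed
    [u], gives the bounds W u x below [x] and 1 - W u x above; their averages [p] and 1 - p are what
    [mass_below_eq] needs. *)
Lemma mixture_mass_below (R : realType) (Om Th : set R) (W : R -> R -> R)
    (c : R -> R) (C : R -> \bar R) (x p : R) :
  measurable Om -> open Th -> is_interval Th ->
  (forall s, Th s -> measurable_fun Om (W ^~ s)) ->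
  (forall u s t, Om u -> Th s -> Th t -> s <= t -> W u s <= W u t) ->
  (forall u s, Om u -> Th s -> derivable (W u) s 1) ->
  (forall u s, Om u -> Th s -> 0 <= W u s <= 1) ->
  measurable_fun Om c -> (forall u, Om u -> 0 <= c u) ->
  (\int[lebesgue_measure]_(u in Om) (c u)%:E = 1)%E ->
  (forall s, Th s -> C s =
     \int[lebesgue_measure]_(u in Om) (derive1 (W u) s * c u)%:E)%E ->
  Th x -> (\int[lebesgue_measure]_(u in Om) (c u * W u x)%:E = p%:E)%E ->
  (forall a : R, 0 < a < 1 -> exists J, [/\ measurable J, J `<=` Th &
     (\int[lebesgue_measure]_(s in J) C s = (1 - a)%:E)%E]) ->
  [/\ measurable_fun Th C, (forall s, Th s -> 0 <= C s)%E,
    (\int[lebesgue_measure]_(s in Th `&` [set` `]-oo, x[]) C s = p%:E)%E &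
    (\int[lebesgue_measure]_(s in Th) C s = 1)%E].
Proof.
move=> mO oTh Thitv mW ndW dW bW mc c0 c1 CE Thx pE tot.
have mTh : measurable Th by exact: open_measurable.
have cW u s : Om u -> Th s -> {for s, continuous (W u)}.
  by move=> Ou Ts; apply: differentiable_continuous; exact/derivable1_diffP/dW.
(* Tonelli needs joint measurability; it comes from monotonicity and continuity in the second
   variable. *)
have mdW : measurable_fun (Om `*` Th) (fun q : R * R => derive1 (W q.1) q.2).
  by apply: measurable_derive1_param => //; exact: measurable_monotone_param.
have dW0 u s : Om u -> Th s -> 0 <= derive1 (W u) s.
  move=> Ou Ts; apply: (@derive1_monotone_ge0 _ Th) => //.
  - by move=> y z; exact: ndW.
  - exact: dW.
pose F (q : R * R) := (derive1 (W q.1) q.2 * c q.1)%:E.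
have mF : measurable_fun (Om `*` Th) F.
  apply/measurable_EFinP; apply: measurable_funM => //.
  apply: (@measurable_comp _ _ _ _ _ _ Om c _ fst) => //.
    by move=> _ [[u s] [/= Ou _] <-].
  by apply: measurable_funTS; exact: measurable_fst.
have F0 u s : Om u -> Th s -> (0 <= F (u, s))%E.
  by move=> Ou Ts; rewrite lee_fin mulr_ge0 ?dW0 ?c0.
pose F' (q : R * R) := F (q.2, q.1).
have mF' : measurable_fun (Th `*` Om) F'.
  apply: (@measurable_comp _ _ _ _ _ _ (Om `*` Th) F _ (fun q => (q.2, q.1))) => //.
  - exact: measurableX.
  - by move=> _ [[s u] [/= Ts Ou] <-].
  - by apply: measurable_funTS; apply/measurable_fun_pair.
have mC : measurable_fun Th C.
  apply: eq_measurable_fun (@measurable_integral_setX _ _ (measurableTypeR R)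
    (measurableTypeR R) R lebesgue_measure Th Om F' mTh mO mF' _).
    by move=> s /set_mem Ts; rewrite CE.
  by move=> s u Ts Ou; exact: F0.
have C0 s : Th s -> (0 <= C s)%E.
  by move=> Ts; rewrite CE//; apply: integral_ge0 => u Ou; exact: F0.
have swap J : measurable J -> J `<=` Th ->
    (\int[lebesgue_measure]_(s in J) C s =
     \int[lebesgue_measure]_(u in Om) \int[lebesgue_measure]_(s in J) F (u, s))%E.
  move=> mJ JTh; rewrite (@tonelli_setX _ _ (measurableTypeR R) (measurableTypeR R) R
    lebesgue_measure lebesgue_measure Om J F)//.
  - by apply: eq_integral => s /set_mem/JTh/CE.
  - apply: measurable_funS mF; first exact: measurableX.
    by move=> [u s] [/= Ou /JTh].
  - by move=> u s Ou /JTh; exact: F0.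
have bound J (w : R -> R) : measurable J -> J `<=` Th -> measurable_fun Om w ->
    (forall u, Om u ->
      (\int[lebesgue_measure]_(s in J) (derive1 (W u) s)%:E <= (w u)%:E)%E) ->
    (\int[lebesgue_measure]_(s in J) C s <=
     \int[lebesgue_measure]_(u in Om) (c u * w u)%:E)%E.
  move=> mJ JTh mw hw; rewrite swap//; apply: ge0_le_integral => //.
  - by move=> u Ou; apply: integral_ge0 => s /JTh; exact: F0.
  - apply: (@measurable_integral_setX _ _ (measurableTypeR R)
      (measurableTypeR R) R lebesgue_measure Om J F) => //.
      apply: measurable_funS mF; first exact: measurableX.
      by move=> [u s] [/= Ou /JTh].
    by move=> u s Ou /JTh; exact: F0.
  - by apply/measurable_EFinP; exact: measurable_funM.
  - move=> u Ou; rewrite EFinM /F /=.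
    under eq_integral => s _ do rewrite mulrC EFinM.
    rewrite ge0_integralZl_EFin ?c0//.
    + by apply: lee_wpmul2l; rewrite ?lee_fin ?c0 ?hw.
    + by move=> s /JTh Ts; rewrite lee_fin dW0.
    + apply/measurable_EFinP; apply: (@measurable_funS _ _ _ _ Th) => //.
      apply: (@measurable_derive1_monotone _ Th) => //.
      * by move=> y z; exact: ndW.
      * by move=> y; exact: dW.
(* The two averages add up to the mass 1 of [c], and the finite [p] may be subtracted. *)
have cint : (\int[lebesgue_measure]_(u in Om) (c u * (1 - W u x))%:E = (1 - p)%:E)%E.
  have : (\int[lebesgue_measure]_(u in Om) (c u * W u x)%:E +
      \int[lebesgue_measure]_(u in Om) (c u * (1 - W u x))%:E = 1)%E.
    rewrite -c1 -ge0_integralD//.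
    - by apply: eq_integral => u _; rewrite -EFinD -mulrDr addrC subrK mulr1.
    - by move=> u Ou; rewrite lee_fin mulr_ge0 ?c0//; case/andP: (bW _ _ Ou Thx).
    - by apply/measurable_EFinP; apply: measurable_funM => //; exact: mW.
    - move=> u Ou; rewrite lee_fin mulr_ge0 ?c0// subr_ge0.
      by case/andP: (bW _ _ Ou Thx).
    - apply/measurable_EFinP; apply: measurable_funM => //.
      by apply: measurable_funB => //; exact: mW.
  rewrite pE => E; rewrite EFinB -E addeAC subee// add0e//.
have [below total] : (\int[lebesgue_measure]_(s in Th `&` [set` `]-oo, x[]) C s = p%:E)%E /\
    (\int[lebesgue_measure]_(s in Th) C s = 1)%E.
  apply: mass_below_eq => //.
  - rewrite -pE; apply: bound => //.
    + by apply: measurableI => //; exact: measurable_itv.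
    + exact: mW.
    + move=> u Ou; apply: integral_derive1_below => //.
      * by move=> y z; exact: ndW.
      * by move=> y; exact: dW.
      * by move=> y Ty; case/andP: (bW _ _ Ou Ty).
  - rewrite -cint; apply: (bound _ (fun u => 1 - W u x)) => //.
    + by apply: measurableI => //; exact: measurable_itv.
    + by apply: measurable_funB => //; exact: mW.
    + move=> u Ou; apply: integral_derive1_above => //.
      * by move=> y z; exact: ndW.
      * by move=> y; exact: dW.
      * by move=> y Ty; case/andP: (bW _ _ Ou Ty).
by split.
Qed.

(** Both sides are the double integral of c(u) h(s) over u <= s: integrating over [s] first produces
    [w], over [u] first produces [F]. *)
Lemma integral_below_above (R : realType) (Om : set R) (c h F w : R -> R) :
  measurable Om -> measurable_fun Om c -> measurable_fun Om h ->
  (forall u, Om u -> 0 <= c u) -> (forall u, Om u -> 0 <= h u) ->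
  (forall s, Om s ->
    \int[lebesgue_measure]_(u in Om `&` [set` `]-oo, s[]) (c u)%:E = (F s)%:E)%E ->
  (forall u, Om u ->
    \int[lebesgue_measure]_(s in Om `&` [set` `[u, +oo[]) (h s)%:E = (w u)%:E)%E ->
  (\int[lebesgue_measure]_(u in Om) (c u * w u)%:E =
   \int[lebesgue_measure]_(s in Om) (h s * F s)%:E)%E.
Proof.
move=> mO mc mh c0 h0 cF hw.
pose S := [set q : R * R | q.1 <= q.2].
have mS : measurable S.
  have -> : S = setT `&` (fun q : R * R => q.2 - q.1) @^-1` [set` `[0, +oo[].
    by apply/seteqP; split=> q /=; rewrite /S/= in_itv/= andbT subr_ge0// => -[].
  by apply: measurable_funB => //; exact: measurable_itv.
have SE (u s : R) : \1_S (u, s) = (u <= s)%R%:R :> R.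
  rewrite indicE; congr (nat_of_bool _)%:R.
  by apply/idP/idP => [/set_mem//|us]; exact/mem_set.
pose G (q : R * R) := (c q.1 * h q.2 * \1_S q)%:E.
have mG : measurable_fun (Om `*` Om) G.
  apply/measurable_EFinP; apply: measurable_funM; last first.
    by apply: measurable_funTS; exact: measurable_indic.
  apply: measurable_funM.
    apply: (@measurable_comp _ _ _ _ _ _ Om c _ fst) => //.
      by move=> _ [[u s] [/= Ou _] <-].
    by apply: measurable_funTS; exact: measurable_fst.
  apply: (@measurable_comp _ _ _ _ _ _ Om h _ snd) => //.
    by move=> _ [[u s] [_ /= Os] <-].
  by apply: measurable_funTS; exact: measurable_snd.
have G0 u s : Om u -> Om s -> (0 <= G (u, s))%E.
  by move=> Ou Os; rewrite lee_fin !mulr_ge0 ?c0 ?h0.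
transitivity (\int[lebesgue_measure]_(u in Om) \int[lebesgue_measure]_(s in Om) G (u, s))%E.
  apply: eq_integral => u /set_mem Ou.
  rewrite EFinM -hw// -ge0_integralZl_EFin ?c0//; last 3 first.
  - by apply: measurableI => //; exact: measurable_itv.
  - by move=> s [Os _]; rewrite lee_fin h0.
  - apply/measurable_EFinP; apply: measurable_funS mh => //; exact: subIsetl.
  rewrite integral_mkcondr; apply: eq_integral => s _.
  rewrite patchE /G SE mem_setE in_itv /= andbT.
  by case: (u <= s); rewrite ?mulr1 ?mulr0 -?EFinM.
rewrite (@tonelli_setX _ _ (measurableTypeR R) (measurableTypeR R) R
  lebesgue_measure lebesgue_measure Om Om G)//.
apply: eq_integral => s /set_mem Os.
have -> : (\int[lebesgue_measure]_(u in Om) G (u, s) =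
    \int[lebesgue_measure]_(u in Om `&` [set` `]-oo, s]]) ((h s)%:E * (c u)%:E))%E.
  rewrite integral_mkcondr; apply: eq_integral => u _.
  rewrite patchE /G SE mem_setE in_itv /=.
  by case: (u <= s); rewrite ?mulr1 ?mulr0 -?EFinM// mulrC.
rewrite ge0_integralZl_EFin ?h0//; last 3 first.
- by apply: measurableI => //; exact: measurable_itv.
- by move=> u [Ou _]; rewrite lee_fin c0.
- by apply/measurable_EFinP; apply: measurable_funS mc => //; exact: subIsetl.
rewrite EFinM -cF//; congr (_ * _)%E.
(* [F] is the mass of an open ray while the region u <= s gives a closed one; the extra point is
   null. *)
have -> : Om `&` [set` `]-oo, s]] = (Om `&` [set` `]-oo, s[]) `|` [set s].
  apply/seteqP; split=> u /=; rewrite !in_itv/= le_eqVlt.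
    by move=> [Ou /predU1P[->|us]]; [right|left].
  by move=> [[Ou ->]|->]; rewrite ?orbT ?eqxx.
rewrite ge0_integral_setU.
- by rewrite integral_set1 adde0.
- by apply: measurableI => //; exact: measurable_itv.
- exact: measurable_set1.
- by apply/measurable_EFinP; apply: (measurable_funS mO _ mc) => u [[]|->].
- by move=> u [[Ou _]|->]; rewrite lee_fin c0.
- by apply/disj_setPS => u [[_ /=]]; rewrite in_itv/= => us E; move: us; rewrite E ltxx.
Qed.

(** * Coverage of the confidence and prediction intervals *)

Unset Implicit Arguments.

Theorem theorem5 (R : realType) (d : measure_display) (Y : measurableType d)
  (mu : {sigma_finite_measure set Y -> \bar R})
  (Omega Theta : set R) (f : Y -> R -> R) (g : R -> R -> R) (T : Y -> R)
  (* scalar parameter spaces *)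
  (Omega_open : open Omega) (Omega_itv : is_interval Omega)
  (Theta_open : open Theta) (Theta_itv : is_interval Theta)
  (* the model f(y|u) *)
  (f_meas : measurable_fun ([set: Y] `*` Omega) (fun p : Y * R => f p.1 p.2))
  (f_ge0 : forall y u, Omega u -> 0 <= f y u)
  (f_mass : forall u, Omega u -> cond_prob mu f u [set: Y] = 1%E)
  (* the model f_theta(u) *)
  (g_meas : forall theta, Theta theta -> measurable_fun Omega (g theta))
  (g_ge0 : forall theta u, Theta theta -> Omega u -> 0 <= g theta u)
  (g_mass : forall theta, Theta theta ->
     unknown_prob Omega g theta [set: R] = 1%E)
  (* the sufficient statistic *)
  (T_meas : measurable_fun [set: Y] T)
  (T_suff : sufficient mu Omega f T)
  (* strictly increasing quantiles *)
  (T_quantile : forall alpha : R, 0 < alpha < 1 ->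
     forall u v, Omega u -> Omega v -> u < v ->
       quantile (fun B => cond_prob mu f u (T @^-1` B)) alpha
       < quantile (fun B => cond_prob mu f v (T @^-1` B)) alpha)
  (U_quantile : forall alpha : R, 0 < alpha < 1 ->
     forall s t, Theta s -> Theta t -> s < t ->
       quantile (unknown_prob Omega g s) alpha
       < quantile (unknown_prob Omega g t) alpha)
  (* the gradients exist *)
  (T_diff : forall y u, Omega u -> derivable (upper_T mu f T (T y)) u 1)
  (U_diff : forall theta u, Theta theta -> Omega u ->
     derivable (upper_U Omega g u) theta 1)
  (* the quotients c_0 and c'_0 are meaningful (0 / 0 is read as 0) *)
  (c0_def : forall y u, Omega u -> f y u = 0 -> conf_u mu f T u y = 0)
  (c0'_def : forall theta u, Theta theta -> Omega u -> g theta u = 0 ->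
     conf_theta_given_u Omega g theta u = 0)
  (* the interval procedures alpha, t |-> CI_alpha(t), PI_alpha(t) *)
  (CI PI : R -> R -> set R)
  (CI_itv : forall (alpha : R) (y : Y), 0 < alpha < 1 ->
     is_interval (CI alpha (T y)) /\ CI alpha (T y) `<=` Theta)
  (PI_itv : forall (alpha : R) (y : Y), 0 < alpha < 1 ->
     is_interval (PI alpha (T y)) /\ PI alpha (T y) `<=` Omega)
  (CI_event : forall alpha theta : R, 0 < alpha < 1 -> Theta theta ->
     measurable [set y | CI alpha (T y) theta])
  (PI_event : forall alpha u : R, 0 < alpha < 1 -> Omega u ->
     measurable [set y | PI alpha (T y) u])
  (CI_tail : forall alpha : R, 0 < alpha < 1 ->
     fixed_tail_split Theta (conf_theta mu Omega f g T)
       (fun y => CI alpha (T y)))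
  (PI_tail : forall alpha : R, 0 < alpha < 1 ->
     fixed_tail_split Omega (fun u y => (conf_u mu f T u y)%:E)
       (fun y => PI alpha (T y)))
  (CI_conf : forall (alpha : R) (y : Y), 0 < alpha < 1 ->
     (\int[lebesgue_measure]_(theta in CI alpha (T y))
        conf_theta mu Omega f g T theta y)%E = (1 - alpha)%:E)
  (PI_conf : forall (alpha : R) (y : Y), 0 < alpha < 1 ->
     (\int[lebesgue_measure]_(u in PI alpha (T y))
        (conf_u mu f T u y)%:E)%E = (1 - alpha)%:E) :
  forall alpha theta0 u0 : R, 0 < alpha < 1 -> Theta theta0 -> Omega u0 ->
    marginal_prob mu Omega f g theta0 [set y | CI alpha (T y) theta0]
      = (1 - alpha)%:E
    /\ cond_prob mu f u0 [set y | PI alpha (T y) u0] = (1 - alpha)%:E.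
Proof.
move=> alpha theta0 u0 a01 Th0 Om0.
have mO : measurable Omega by exact: open_measurable.
have mTh : measurable Theta by exact: open_measurable.
have mTi (i : interval R) : measurable (T @^-1` [set` i]).
  by rewrite -[_ @^-1` _]setTI; apply: T_meas => //; exact: measurable_itv.
pose QT v B := cond_prob mu f v (T @^-1` B).
have QTm u : Omega u -> exists2 m : {measure set R -> \bar R},
    m [set: R] = 1%E & forall B, measurable B -> m B = QT u B.
  move=> Ou; have [m mE] := cond_prob_measure mu mO f_meas f_ge0 Ou.
  have [n nE] := pushforward_measure m T_meas.
  by exists n => [|B _]; rewrite nE mE ?preimage_setT ?f_mass.
pose QU := unknown_prob Omega g.
have QUm s : Theta s -> exists2 m : {measure set R -> \bar R},
    m [set: R] = 1%E & forall B, measurable B -> m B = QU s B.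
  move=> Ts; have [m mE] := unknown_prob_measure mO (g_meas s Ts) (fun u => g_ge0 s u Ts).
  by exists m => [|B _]; rewrite mE ?g_mass.
have T_mono y u v : Omega u -> Omega v -> u <= v ->
    upper_T mu f T (T y) u <= upper_T mu f T (T y) v.
  by move=> Ou Ov; exact: (survival_monotone QTm T_quantile).
have T_range y u : Omega u -> 0 <= upper_T mu f T (T y) u <= 1.
  by move=> Ou; apply: (survival_range QTm Ou (measurable_itv `[T y, +oo[)).2.
have T_fin y u : Omega u ->
    (upper_T mu f T (T y) u)%:E = cond_prob mu f u (T @^-1` [set` `[T y, +oo[]).
  by move=> Ou; rewrite fineK//; apply: (survival_range QTm Ou (measurable_itv `[T y, +oo[)).1.
(* Differentiability of the P-value in u supplies the continuity that excludes atoms. *)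
have T_atom y u : Omega u -> cond_prob mu f u (T @^-1` [set T y]) = 0%E.
  move=> Ou; apply: (survival_no_atom Omega_open QTm T_quantile Ou).
  by apply: differentiable_continuous; exact/derivable1_diffP/(T_diff y u Ou).
have c_meas y : measurable_fun Omega (fun u => conf_u mu f T u y).
  apply: measurable_derive1_monotone => // [u v|u]; [exact: T_mono|exact: T_diff].
have c_ge0 y u : Omega u -> 0 <= conf_u mu f T u y.
  move=> Ou; apply: (@derive1_monotone_ge0 _ Omega) => // [v w|]; [exact: T_mono|exact: T_diff].
have c_mass y u : Omega u ->
    (\int[lebesgue_measure]_(v in Omega `&` [set` `]-oo, u[]) (conf_u mu f T v y)%:E
       = (upper_T mu f T (T y) u)%:E)%E /\
    (\int[lebesgue_measure]_(v in Omega) (conf_u mu f T v y)%:E = 1)%E.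
  move=> Ou; apply: mass_below_eq => //.
  - exact/measurable_EFinP.
  - by move=> v Ov; rewrite lee_fin c_ge0.
  (* The prediction intervals at all levels [a] are the sets of mass 1 - a that force the total mass
     up to 1. *)
  - move=> a ha; have [Pitv PO] := PI_itv a y ha.
    exists (PI a (T y)); split => //; first exact: is_interval_measurable.
    exact: PI_conf.
  - apply: integral_derive1_below => // [v w|v|v Ov]; [exact: T_mono|exact: T_diff|].
    by case/andP: (T_range y v Ov).
  - apply: integral_derive1_above => // [v w|v|v Ov]; [exact: T_mono|exact: T_diff|].
    by case/andP: (T_range y v Ov).
have alpha01 : 0 <= alpha <= 1 by case/andP: a01 => /ltW -> /ltW ->.
split; last first.
  have [m mE] := cond_prob_measure mu mO f_meas f_ge0 Om0.
  rewrite -(mE [set y | PI alpha (T y) u0]).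
  apply: (@coverage _ _ _ m T Omega
    (fun u y => (conf_u mu f T u y)%:E) (fun y => PI alpha (T y))).
  - by rewrite mE f_mass.
  - exact: T_meas.
  - by move=> y; rewrite mE T_atom.
  - exact: Omega_itv.
  - by move=> y; exact/measurable_EFinP.
  - by move=> y v Ov; rewrite lee_fin c_ge0.
  - by move=> y; rewrite (c_mass y _ Om0).2.
  - by move=> y; rewrite (c_mass y _ Om0).1 mE T_fin.
  - exact: Om0.
  - by move=> y; exact: PI_itv.
  - exact: PI_event.
  - exact: PI_tail.
  - by move=> y; exact: PI_conf.
  - exact: alpha01.
have U_mono u s t : Theta s -> Theta t -> s <= t ->
    upper_U Omega g u s <= upper_U Omega g u t.
  by move=> Ts Tt; exact: (survival_monotone QUm U_quantile).
have U_range u s : Theta s -> 0 <= upper_U Omega g u s <= 1.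
  by move=> Ts; apply: (survival_range QUm Ts (measurable_itv `[u, +oo[)).2.
have U_fin u s : Theta s ->
    (upper_U Omega g u s)%:E = unknown_prob Omega g s [set` `[u, +oo[].
  by move=> Ts; rewrite fineK//; apply: (survival_range QUm Ts (measurable_itv `[u, +oo[)).1.
have U_meas s : Theta s -> measurable_fun Omega (fun u => upper_U Omega g u s).
  move=> Ts; apply: nonincreasing_measurable => // u v uv.
  rewrite -lee_fin !U_fin//; have [n n1 nE] := QUm _ Ts.
  rewrite -/QU -!nE ?measurable_itv//; apply: le_measure; rewrite ?inE ?measurable_itv//.
  by move=> z /=; rewrite !in_itv/= !andbT; exact: le_trans.
have [m mE] := marginal_prob_measure mu mO f_meas f_ge0 (g_meas _ Th0)
  (fun u => g_ge0 _ u Th0).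
have margE A : measurable A -> marginal_prob mu Omega f g theta0 A =
    (\int[lebesgue_measure]_(u in Omega) ((g theta0 u)%:E * cond_prob mu f u A))%E.
  move=> mA; apply: eq_integral => u /set_mem Ou.
  rewrite /cond_prob -ge0_integralZl_EFin ?g_ge0//.
  - by apply: eq_integral => y _; rewrite -EFinM mulrC.
  - by move=> y _; rewrite lee_fin f_ge0.
  - apply/measurable_EFinP; apply: measurable_funTS.
    exact: measurable_fun_section2 measurableT mO f_meas Ou.
have m1 : m [set: Y] = 1%E.
  rewrite mE// margE//; rewrite -(g_mass _ Th0) /unknown_prob setIT.
  by apply: eq_integral => u /set_mem Ou; rewrite f_mass// mule1.
have C_facts y : [/\ measurable_fun Theta (fun s => conf_theta mu Omega f g T s y),
    (forall s, Theta s -> 0 <= conf_theta mu Omega f g T s y)%E,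
    (\int[lebesgue_measure]_(s in Theta `&` [set` `]-oo, theta0[])
       conf_theta mu Omega f g T s y =
     (fine (m (T @^-1` [set` `[T y, +oo[])))%:E)%E &
    (\int[lebesgue_measure]_(s in Theta) conf_theta mu Omega f g T s y = 1)%E].
  (* The likelihood factors cancel against the denominators of c_0 and c'_0; where a density
     vanishes, [c0_def] and [c0'_def] make both sides 0. *)
  have CE s : Theta s -> (conf_theta mu Omega f g T s y =
      \int[lebesgue_measure]_(u in Omega)
        (derive1 (upper_U Omega g u) s * conf_u mu f T u y)%:E)%E.
    move=> Ts; apply: eq_integral => u /set_mem Ou; congr EFin.
    rewrite /h_confidence /conf0_theta_given_u /conf0_u /ext_lik.
    rewrite -[derive1 (upper_U Omega g u) s]/(conf_theta_given_u Omega g s u).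
    have [f0|fN0] := eqVneq (f y u) 0; first by rewrite c0_def// mul0r !mulr0 !mul0r.
    have [g0|gN0] := eqVneq (g s u) 0; first by rewrite c0'_def// !mul0r.
    by field; rewrite fN0 gN0.
  have CE0 s : Theta s -> (0 <= conf_theta mu Omega f g T s y)%E.
    move=> Ts; rewrite CE//; apply: integral_ge0 => u Ou; rewrite lee_fin.
    apply: mulr_ge0; last exact: c_ge0.
    apply: (@derive1_monotone_ge0 _ Theta) => //.
      by move=> a b; exact: U_mono.
    exact: U_diff.
  apply: (@mixture_mass_below _ Omega Theta (upper_U Omega g)
    (fun u => conf_u mu f T u y)) => //.
  - by move=> u s t _; exact: U_mono.
  - by move=> u s Ou Ts; exact: U_diff.
  - by move=> u s _; exact: U_range.
  - exact: c_ge0.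
  - exact: (c_mass y _ Om0).2.
  (* Exchanging the roles of the two densities turns the average of P_theta0(U >= u) under c(u; y)
     into the average of P(T >= t | u) under f_theta0, which is the marginal P-value. *)
  - rewrite (@integral_below_above _ Omega _ (g theta0) (upper_T mu f T (T y)))//.
    + have mfin : m (T @^-1` [set` `[T y, +oo[]) \is a fin_num.
        rewrite ge0_fin_numE//; apply: le_lt_trans (ltry 1).
        by rewrite -m1; apply: le_measure; rewrite ?inE.
      rewrite fineK// mE// margE//; apply: eq_integral => u /set_mem Ou.
      by rewrite EFinM T_fin.
    + exact: g_meas.
    + exact: c_ge0.
    + by move=> u; exact: g_ge0.
    + by move=> s Os; exact: (c_mass y _ Os).1.
    + by move=> u Ou; rewrite U_fin.
  - move=> a ha; have [Citv CT] := CI_itv a y ha.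
    exists (CI a (T y)); split => //; first exact: is_interval_measurable.
    exact: CI_conf.
have mev := CI_event _ _ a01 Th0.
rewrite -(mE _ mev).
apply: (@coverage _ _ _ m T Theta
  (conf_theta mu Omega f g T) (fun y => CI alpha (T y))).
- exact: m1.
- exact: T_meas.
(* The marginal law inherits the absence of atoms as a mixture of the conditional laws. *)
- move=> y; rewrite mE; last by rewrite -[_ @^-1` _]setTI; apply: T_meas.
  rewrite margE; last by rewrite -[_ @^-1` _]setTI; apply: T_meas.
  by rewrite integral0_eq// => u Ou; rewrite T_atom// mule0.
- exact: Theta_itv.
- by move=> y; have [] := C_facts y.
- by move=> y; have [] := C_facts y.
- by move=> y; have [_ _ _ ->] := C_facts y.
- move=> y; have [_ _ -> _] := C_facts y; rewrite fineK//.
  rewrite ge0_fin_numE//; apply: le_lt_trans (ltry 1).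
  by rewrite -m1; apply: le_measure; rewrite ?inE.
- exact: Th0.
- by move=> y; exact: CI_itv.
- exact: mev.
- exact: CI_tail.
- by move=> y; exact: CI_conf.
- exact: alpha01.
Qed.
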